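(* The Lelek fan is a universal continuum for smooth fans. That is, if $L$ is a Lelek fan, then $L$ is a smooth fan, and for every smooth fan $Z$ there exists a topological embedding $Z\to L$ (a continuous map that is a homeomorphism onto its image).
   Context: A continuum is a non-empty compact connected metric space; a subcontinuum is a subspace of a continuum which is itself a continuum. An arc is a space homeomorphic to $[0,1]$. A Cantor set is a space homeomorphic to the standard middle-third Cantor set. A continuum $X$ is a Cantor fan if $X$ is homeomorphic to the continuum $\bigcup_{c\in C}A_c$, where $C\subseteq[0,1]$ is a Cantor set and for each $c\in C$, $A_c$ is the convex segment in the plane from $(0,0)$ to $(c,-1)$. Let $X$ be a Cantor fan and let $Y$ be a subcontinuum of $X$. A point $x\in Y$ is an end-point of $Y$ if for every arc $A$ in $Y$ that contains $x$, $x$ is an end-point of $A$. The set of all end-points of $Y$ is denoted by $E(Y)$. A non-degenerate (i.e. having more than one point) subcontinuum $Y$ of a Cantor fan $X$ is a Lelek fan if $\operatorname{Cl}(E(Y))=Y$, where the closure is taken in $Y$. A continuum homeomorphic to such a $Y$ is also called a Lelek fan. (Any two Lelek fans are homeomorphic, which justifies speaking of ''the'' Lelek fan.) A continuum is unicoherent if whenever it is the union of two subcontinua, their intersection is connected; it is hereditarily unicoherent if each of its subcontinua is unicoherent. A dendroid is an arcwise connected, hereditarily unicoherent continuum; in a dendroid, any two distinct points $a,b$ are the end-points of a unique arc, denoted $[a,b]$ (and $[a,a]=\{a\}$). A ramification point of a dendroid is a point $t$ that is a common end-point of three arcs any two of which meet only in $t$. A fan is a dendroid with exactly one ramification point, called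 its top. A fan $Z$ with top $t$ is smooth if for every sequence $(x_n)$ in $Z$ converging to a point $x\in Z$, the sequence $[t,x_n]$ converges to $[t,x]$ in the Hausdorff metric. A continuum is universal for a family of continua if it belongs to the family and every member of the family embeds in it. *)

(* Defs.v *)
From HB Require Import structures.
From mathcomp Require Import all_boot all_order all_algebra.
From mathcomp Require Import all_classical all_reals all_analysis.

Set Implicit Arguments.
Unset Strict Implicit.
Unset Printing Implicit Defensive.

Import Order.TTheory GRing.Theory Num.Theory.
Import numFieldNormedType.Exports.

Local Open Scope classical_set_scope.
Local Open Scope ring_scope.

(* A space is a subset of an ambient topological or metric space, with the
   subspace topology: {within A, continuous f} is continuity of f restricted
   to A. The values of f outside A and of g outside B are irrelevant. *)
Definition homeomorphism (S T : topologicalType) (A : set S) (B : set T)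
    (f : S -> T) : Prop :=
  exists g : T -> S,
    [/\ {within A, continuous f} /\ {within B, continuous g},
        (forall x, A x -> B (f x)),
        (forall y, B y -> A (g y)),
        (forall x, A x -> g (f x) = x)
      & (forall y, B y -> f (g y) = y)].

Definition homeomorphic (S T : topologicalType) (A : set S) (B : set T) : Prop :=
  exists f : S -> T, homeomorphism A B f.

Definition embeds (S T : topologicalType) (A : set S) (B : set T) : Prop :=
  exists f : S -> T, f @` A `<=` B /\ homeomorphism A (f @` A) f.

Section Continua.
Context {R : realType}.

Definition continuum (T : metricType R) (X : set T) : Prop :=
  [/\ X !=set0, compact X & connected X].

Definition subcontinuum (T : metricType R) (Y X : set T) : Prop :=
  Y `<=` X /\ continuum Y.

Definition nondegenerate (T : metricType R) (X : set T) : Prop :=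
  exists x y, [/\ X x, X y & x <> y].

Definition arc (T : metricType R) (A : set T) : Prop :=
  homeomorphic A (`[0, 1]%classic : set R).

Definition arc_between (T : metricType R) (A : set T) (a b : T) : Prop :=
  exists h : R -> T,
    [/\ homeomorphism (`[0, 1]%classic : set R) A h, h 0 = a & h 1 = b].

Definition arc_endpoint (T : metricType R) (A : set T) (x : T) : Prop :=
  exists a b, arc_between A a b /\ (x = a \/ x = b).

Fixpoint middle_thirds_stage (n : nat) : set R :=
  if n is m.+1 then
    [set x / 3 | x in middle_thirds_stage m] `|`
    [set 2 / 3 + x / 3 | x in middle_thirds_stage m]
  else `[0, 1]%classic.

Definition middle_third_cantor : set R :=
  \bigcap_(n in [set: nat]) middle_thirds_stage n.

Definition cantor_set (C : set R) : Prop := homeomorphic C middle_third_cantor.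

Definition plane_segment (p q : R * R) : set (R * R) :=
  [set ((1 - s) * p.1 + s * q.1, (1 - s) * p.2 + s * q.2)
     | s in (`[0, 1]%classic : set R)].

Definition cantor_fan (T : metricType R) (X : set T) : Prop :=
  continuum X /\
  exists C : set R,
    [/\ C `<=` `[0, 1]%classic, cantor_set C
      & homeomorphic X (\bigcup_(c in C) plane_segment (0, 0) (c, -1))].

Definition endpoints (T : metricType R) (Y : set T) : set T :=
  [set x | Y x /\
     forall A : set T, A `<=` Y -> arc A -> A x -> arc_endpoint A x].

(* [closure (endpoints Y) `&` Y] is the closure of E(Y) in the subspace Y. *)
Definition lelek_fan (T : metricType R) (L : set T) : Prop :=
  continuum L /\
  exists (U : metricType R) (X Y : set U),
    [/\ cantor_fan X,
        subcontinuum Y X,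
        nondegenerate Y,
        closure (endpoints Y) `&` Y = Y
      & homeomorphic L Y].

Definition unicoherent (T : metricType R) (X : set T) : Prop :=
  forall A B : set T, continuum A -> continuum B -> A `|` B = X ->
    connected (A `&` B).

Definition hereditarily_unicoherent (T : metricType R) (X : set T) : Prop :=
  forall Y : set T, subcontinuum Y X -> unicoherent Y.

Definition arcwise_connected (T : metricType R) (X : set T) : Prop :=
  forall a b, X a -> X b -> a <> b ->
    exists A : set T, A `<=` X /\ arc_between A a b.

Definition dendroid (T : metricType R) (X : set T) : Prop :=
  [/\ continuum X, arcwise_connected X & hereditarily_unicoherent X].

(* A is the arc [a, b] of the dendroid X, with [a, a] = {a}. The notion is
   relational; in a dendroid exactly one such A exists for a, b in X. *)
Definition is_dendroid_arc (T : metricType R) (X : set T) (a b : T)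
    (A : set T) : Prop :=
  A `<=` X /\ ((a = b /\ A = [set a]) \/ (a <> b /\ arc_between A a b)).

Definition ramification_points (T : metricType R) (X : set T) : set T :=
  [set t | exists A B C : set T,
     [/\ [/\ A `<=` X, B `<=` X & C `<=` X],
         [/\ arc_endpoint A t, arc_endpoint B t & arc_endpoint C t]
       & [/\ A `&` B = [set t], A `&` C = [set t] & B `&` C = [set t]]]].

Definition fan_with_top (T : metricType R) (X : set T) (t : T) : Prop :=
  dendroid X /\ ramification_points X = [set t].

Definition metric_neighborhood (T : metricType R) (r : R) (A : set T) : set T :=
  [set x | exists2 a, A a & mdist a x < r].

(* The Hausdorff metric; meaningful for nonempty compact A and B. *)
Definition hausdorff_dist (T : metricType R) (A B : set T) : R :=
  inf [set r | [/\ 0 < r, A `<=` metric_neighborhood r B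
                 & B `<=` metric_neighborhood r A]].

Definition smooth_fan (T : metricType R) (Z : set T) : Prop :=
  exists t, fan_with_top Z t /\
    forall (x_ : nat -> T) (x : T) (A_ : nat -> set T) (A : set T),
      (forall n, Z (x_ n)) -> Z x -> x_ @ \oo --> x ->
      (forall n, is_dendroid_arc Z t (x_ n) (A_ n)) ->
      is_dendroid_arc Z t x A ->
      (fun n => hausdorff_dist (A_ n) A) @ \oo --> (0 : R).

Definition universal_continuum (P : forall T : metricType R, set T -> Prop)
    (T : metricType R) (L : set T) : Prop :=
  P T L /\ forall (U : metricType R) (Z : set U), P U Z -> embeds Z L.

End Continua.

(* Main.v *)
Require Import Defs.
From mathcomp Require Import all_boot all_order all_algebra.
From mathcomp Require Import all_classical all_reals all_analysis.
From mathcomp Require Import ring lra.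

(* A Lelek fan is homeomorphic to a continuum P in the planar Cantor fan. A
   subcontinuum of the planar fan contains, with any two points, the unique path
   along the legs joining them; this makes P a smooth fan with top 0.

   Conversely, let Z be a smooth fan with top t. The function
   f x = sum_k 2^-k (d(p_k, t) - d(p_k, [t, x])), with (p_k) dense in Z, is
   continuous because x |-> [t, x] is, and it is strictly increasing along every
   leg. A connected subset of {f >= e} lies in one leg, since a subcontinuum that
   meets two legs contains t; hence relatively clopen subsets of {f >= e} separate
   legs, and they extend to {f >= e'} for e' < e. In the limit this yields a
   continuous k : Z \ {t} -> 2^nat that separates legs, so that x |-> (k x, f x)
   embeds Z in the cone over the Cantor set.

   It remains to find such a cone in P. Because the end-points are dense, the set
   of slopes of the legs longer than some h > 0 has no isolated point, so its
   closure contains a Cantor set, and all legs with slope in the closure have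
   length at least h. *)

Set Implicit Arguments.
Unset Strict Implicit.
Unset Printing Implicit Defensive.

Import Order.TTheory GRing.Theory Num.Theory.
Import numFieldNormedType.Exports.

Local Open Scope classical_set_scope.
Local Open Scope ring_scope.

(** * Homeomorphisms and continuity on subsets *)

(** The obstacle is that the legs of Z come without a parametrization: their end-points need not
    form a closed set and legs may shrink to t, so no compact cross-section is at hand. Cutting at f
    >= e gives compact sets, and a relatively clopen subset of such a set is a union of whole
    truncated legs; this is why it can be prolonged towards t, where further legs appear. Countably
    many of the resulting sets suffice, one for each pair of balls of a countable family. The
    sequence k need not converge at t, which is harmless because f vanishes there and slopes are
    bounded. Strict growth of f comes from the closedness of [t, x]: if y lies beyond x, some p_k is
    nearer to y than to [t, x]. On the planar side everything rests on the density of the slopes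
    outside C, which lets thin wedges cut off a leg. Limits along the tree that yields the Cantor
    set of slopes may leave the set of long slopes, so the length bound must pass to limits. *)

Section Homeomorphisms.

Lemma within_comp (S T U : topologicalType) (A : set S) (B : set T)
    (f : S -> T) (g : T -> U) :
  {within A, continuous f} -> (forall x, A x -> B (f x)) ->
  {within B, continuous g} -> {within A, continuous (g \o f)}.
Proof.
move=> /subspace_continuousP fc AB /subspace_continuousP gc.
apply/subspace_continuousP => x Ax V /= Vg.
have := gc _ (AB _ Ax) V Vg; rewrite /fmap /= => wg.
have h : nbhs x (fun y => A y -> B (f y) -> V (g (f y))) := fc _ Ax _ wg.
suff : nbhs x (fun y => A y -> V (g (f y))) by [].
by apply: filterS h => y h Ay; exact: h Ay (AB _ Ay).
Qed.

Lemma homeomorphism_sub (S T : topologicalType) (A A' : set S) (B : set T) f :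
  homeomorphism A B f -> A' `<=` A -> homeomorphism A' (f @` A') f.
Proof.
move=> [g [[fc gc] fAB gBA gf fg]] A'A; exists g; split.
- split; first exact: continuous_subspaceW fc.
  by apply: continuous_subspaceW gc => _ [x /A'A Ax <-]; exact: fAB.
- by move=> x A'x; exists x.
- by move=> _ [x A'x <-]; rewrite gf//; exact: A'A.
- by move=> x /A'A; exact: gf.
- by move=> _ [x /A'A Ax <-]; rewrite gf.
Qed.

Lemma homeomorphism_image (S T : topologicalType) (A : set S) (B : set T) f :
  homeomorphism A B f -> f @` A = B.
Proof.
move=> [g [_ fAB gBA gf fg]]; apply/seteqP; split.
  by move=> _ [x Ax <-]; exact: fAB.
by move=> y By; exists (g y); [exact: gBA|exact: fg].
Qed.

Lemma homeomorphism_inv (S T : topologicalType) (A : set S) (B : set T) f :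
  homeomorphism A B f -> exists g, [/\ homeomorphism B A g,
    forall x, A x -> g (f x) = x & forall y, B y -> f (g y) = y].
Proof. by move=> [g [[fc gc] fAB gBA gf fg]]; exists g; split => //; exists f. Qed.

Lemma homeomorphism_comp (S T U : topologicalType) (A : set S) (B : set T)
    (D : set U) f g :
  homeomorphism A B f -> homeomorphism B D g -> homeomorphism A D (g \o f).
Proof.
move=> [f' [[fc f'c] fAB f'BA ff' f'f]] [g' [[gc g'c] gBD g'DB gg' g'g]].
exists (f' \o g'); split.
- by split; [exact: within_comp gc|exact: within_comp f'c].
- by move=> x /fAB /gBD.
- by move=> x /g'DB /f'BA.
- by move=> x Ax /=; rewrite gg' ?ff'//; exact: fAB.
- by move=> x Dx /=; rewrite f'f ?g'g//; exact: g'DB.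
Qed.

Lemma homeomorphism_continuous (S T : topologicalType) (A : set S) (B : set T)
    f : homeomorphism A B f -> {within A, continuous f}.
Proof. by move=> [g [[]]]. Qed.

Lemma homeomorphism_inj (S T : topologicalType) (A : set S) (B : set T) f :
  homeomorphism A B f -> forall x y, A x -> A y -> f x = f y -> x = y.
Proof. by move=> [g [_ _ _ gf _]] x y Ax Ay fxy; rewrite -(gf x)// fxy gf. Qed.

Lemma compact_injective_homeomorphism (S T : topologicalType) (A : set S)
    (f : S -> T) :
  hausdorff_space T -> A !=set0 -> compact A -> {within A, continuous f} ->
  (forall x y, A x -> A y -> f x = f y -> x = y) ->
  homeomorphism A (f @` A) f.
Proof.
move=> hT [a Aa] cA fc finj.
(* The inverse has to be a total function; off the image it takes the value [a]. *)
have gE y : exists x, (f @` A) y -> A x /\ f x = y.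
  have [[x Ax xy]|nA] := pselect ((f @` A) y); first by exists x.
  by exists a => /nA.
pose g y := sval (cid (gE y)).
have gP y : (f @` A) y -> A (g y) /\ f (g y) = y.
  exact: (svalP (cid (gE y))).
have gf x : A x -> g (f x) = x.
  by move=> Ax; have [Ag fg] := gP (f x) (imageP f Ax); apply: finj.
exists g; split => //.
- split => //; apply/continuous_closedP => D cD.
  apply/closed_subspaceP; exists (f @` (A `&` D)).
    apply: compact_closed => //; apply: continuous_compact.
      by apply: continuous_subspaceW fc; exact: subIsetl.
    by apply: compact_closedI.
  apply/seteqP; split => [_ [[x [Ax Dx] <-] _]|y [Dgy fAy]].
    by split; [change (D (g (f x))); rewrite gf|exists x].
  by have [Ag fg] := gP _ fAy; split => //; exists (g y).
- by move=> y /gP[].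
- by move=> y /gP[].
Qed.

Lemma homeomorphism_compact (S T : topologicalType) (A : set S) (B : set T) f :
  homeomorphism A B f -> compact A -> compact B.
Proof.
move=> hf cA; rewrite -(homeomorphism_image hf); apply: continuous_compact => //.
exact: homeomorphism_continuous hf.
Qed.

Lemma homeomorphism_connected (S T : topologicalType) (A : set S) (B : set T) f :
  homeomorphism A B f -> connected A -> connected B.
Proof.
move=> hf cA; rewrite -(homeomorphism_image hf).
apply: connected_continuous_connected => //.
exact: homeomorphism_continuous hf.
Qed.

(** The sets joining a fixed point to the others all share that point. This is how intersections of
    planar continua are shown to be connected. *)
Lemma connected_paths (T : topologicalType) (A : set T) :
  (forall x y, A x -> A y -> exists2 C, connected C & [/\ C `<=` A, C x & C y]) ->
  connected A.
Proof.
move=> h; have [[a Aa]|A0] := pselect (A !=set0); last first.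
  have -> : A = set0 by apply/seteqP; split => // x Ax; apply: A0; exists x.
  exact: connected0.
pose C x := if pselect (A x) is left Ax then sval (cid2 (h a x Aa Ax)) else set0.
have CP x : A x -> connected (C x) /\ [/\ C x `<=` A, C x a & C x x].
  move=> Ax; rewrite /C; case: pselect => // Ax'.
  by case: cid2 => D.
have -> : A = \bigcup_(x in A) C x.
  apply/seteqP; split => [x Ax|x [y Ay]]; first by exists x => //; have [_ []] := CP _ Ax.
  by have [_ [+ _ _]] := CP _ Ay; exact.
apply: bigcup_connected; last by move=> x /CP[].
by exists a => x /CP[_ []].
Qed.

End Homeomorphisms.

Section WithinContinuity.
Context {R : realType}.

Lemma within_ballP (S T : pseudoMetricType R) (A : set S) (f : S -> T) :
  {within A, continuous f} <->
  (forall x, A x -> forall e, 0 < e -> exists2 d, 0 < d &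
     forall y, A y -> ball x d y -> ball (f x) e (f y)).
Proof.
split=> [/subspace_continuousP fc x Ax e e0|h].
  have := fc x Ax (ball (f x) e) (nbhsx_ballx _ _ e0).
  rewrite /fmap /= /within /= => /nbhs_ballP[d d0 dP].
  by exists d => // y Ay xy; exact: dP.
apply/subspace_continuousP => x Ax V /nbhs_ballP[e e0 eV].
have [d d0 dP] := h x Ax e e0.
apply/nbhs_ballP; exists d => // y xy Ay; apply: eV; exact: dP.
Qed.

(** One good index is enough, since a failure of continuity yields a convergent sequence all of
    whose terms are bad. *)
Lemma within_seqP (S T : pseudoMetricType R) (A : set S) (f : S -> T) :
  (forall (u : nat -> S) x, A x -> (forall n, A (u n)) -> u @ \oo --> x ->
     forall e, 0 < e -> exists n, ball (f x) e (f (u n))) ->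
  {within A, continuous f}.
Proof.
move=> h; apply/within_ballP => x Ax e e0; apply: contrapT => nd.
have uE (n : nat) : exists y, [/\ A y, ball x n.+1%:R^-1 y & ~ ball (f x) e (f y)].
  apply: contrapT => ny; apply: nd; exists n.+1%:R^-1 => // y Ay xy.
  by apply: contrapT => nb; apply: ny; exists y.
pose u n := sval (cid (uE n)).
have uP n : [/\ A (u n), ball x n.+1%:R^-1 (u n) & ~ ball (f x) e (f (u n))].
  exact: svalP (cid (uE n)).
have [| |n bn] := h u x Ax _ _ e e0; last by have [_ _] := uP n.
  by move=> n; have [] := uP n.
apply/cvg_ballP => d d0.
have := near_infty_natSinv_lt (PosNum d0).
apply: filterS => n /= nd'.
by have [_ + _] := uP n; apply: le_ball; exact: ltW.
Qed.

Lemma closed_ballP (T : pseudoMetricType R) (A : set T) :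
  closed A <-> forall x, ~ A x -> exists2 e, 0 < e & forall y, ball x e y -> ~ A y.
Proof.
split=> [cA x nAx|h].
  have : nbhs x (~` A).
    by apply: open_nbhs_nbhs; split => //; exact: closed_openC.
  by move/nbhs_ballP => [e e0 eA]; exists e.
rewrite -openC openE => x nAx; rewrite /interior /=.
by have [e e0 eA] := h x nAx; apply/nbhs_ballP; exists e.
Qed.

End WithinContinuity.

(** * Arcs and subcontinua *)

Section Arcs.
Context {R : realType}.
Implicit Type T : metricType R.

Local Notation I01 := (`[0, 1]%classic : set R).

Lemma continuous_affine (a b : R) : continuous (fun s : R => a + s * b).
Proof.
move=> s; apply: cvgD; first exact: cvg_cst.
by apply: cvgM; [exact: cvg_id|exact: cvg_cst].
Qed.

Lemma affine_homeomorphism (a b : R) : a < b ->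
  homeomorphism I01 `[a, b] (fun s => a + s * (b - a)).
Proof.
move=> ab.
have ab0 : 0 < b - a by rewrite subr_gt0.
have -> : `[a, b]%classic = (fun s => a + s * (b - a)) @` I01.
  apply/seteqP; split => [s|y [s /=]]; rewrite /= !in_itv /=.
    move=> /andP[as_ sb]; exists ((s - a) / (b - a)); last first.
      by rewrite divfK ?gt_eqF// addrC subrK.
    rewrite in_itv /= divr_ge0 ?subr_ge0 ?(ltW ab)//=.
    by rewrite ler_pdivrMr// mul1r lerB.
  by move=> /andP[s0 s1] <-; apply/andP; split; nra.
apply: compact_injective_homeomorphism.
- exact: order_hausdorff.
- by exists 0; rewrite /= in_itv /= lexx ler01.
- exact: segment_compact.
- by apply: continuous_subspaceT; exact: continuous_affine.
- move=> x y _ _ /addrI /mulIf; apply; by rewrite gt_eqF.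
Qed.

Lemma reverse_homeomorphism : homeomorphism I01 I01 (fun s => 1 - s).
Proof.
have i01 (x : R) : I01 x -> I01 (1 - x).
  by rewrite /= !in_itv /= => /andP[? ?]; apply/andP; split; lra.
have c1 : {within I01, continuous (fun s : R => 1 - s)}.
  apply: continuous_subspaceT => s; apply: cvgB; first exact: cvg_cst.
  exact: cvg_id.
exists (fun s => 1 - s); split => //.
- by move=> x _; rewrite subKr.
- by move=> x _; rewrite subKr.
Qed.

(** Pulled back to the parameter, [S] is a connected set of reals, hence an interval. *)
Lemma connected_in_arc (T : topologicalType) (A S : set T) (h : R -> T) (a b : R) :
  homeomorphism I01 A h -> connected S -> S `<=` A -> 0 <= a -> b <= 1 ->
  S (h a) -> S (h b) -> h @` `[a, b] `<=` S.
Proof.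
move=> [g [[hc gc] hA gI gh hg]] cS SA a0 b1 Sa Sb _ [s /= + <-].
rewrite in_itv /= => /andP[as_ sb].
have ab := le_trans as_ sb.
have : is_interval (g @` S).
  apply/connected_intervalP; apply: connected_continuous_connected => //.
  exact: continuous_subspaceW gc.
have i01 x : a <= x -> x <= b -> I01 x.
  by move=> ax xb; rewrite /= in_itv /= (le_trans a0)//= (le_trans xb).
move=> /(_ a b) /(_ _ _ s) [| | |x Sx gxs].
- by exists (h a) => //; rewrite gh//; exact: i01.
- by exists (h b) => //; rewrite gh//; exact: i01.
- by rewrite as_ sb.
- by rewrite -gxs hg//; exact: SA.
Qed.

Lemma arc_between_sym T (A : set T) a b : arc_between A a b -> arc_between A b a.
Proof.
move=> [h [hh h0 h1]]; exists (h \o (fun s => 1 - s)); split => /=.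
- by apply: homeomorphism_comp hh; exact: reverse_homeomorphism.
- by rewrite subr0.
- by rewrite subrr.
Qed.

Lemma subarc T (A : set T) (h : R -> T) (a b : R) :
  homeomorphism I01 A h -> 0 <= a -> a < b -> b <= 1 ->
  arc_between (h @` `[a, b]) (h a) (h b).
Proof.
move=> hh a0 ab b1; exists (h \o (fun s => a + s * (b - a))); split => /=.
- apply: homeomorphism_comp (affine_homeomorphism ab) _.
  apply: homeomorphism_sub hh _ => x /=; rewrite !in_itv /= => /andP[? ?].
  by apply/andP; split; lra.
- by rewrite mul0r addr0.
- by rewrite mul1r addrC subrK.
Qed.

Lemma zero_I01 : I01 0. Proof. by rewrite /= in_itv /= lexx ler01. Qed.
Lemma one_I01 : I01 1. Proof. by rewrite /= in_itv /= lexx ler01. Qed.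

Lemma arc_param_continuum T (A : set T) (h : R -> T) :
  homeomorphism I01 A h -> continuum A.
Proof.
move=> hh; split.
- by exists (h 0); rewrite -(homeomorphism_image hh); exact: imageP zero_I01.
- by apply: homeomorphism_compact hh _; exact: segment_compact.
- by apply: homeomorphism_connected hh _; exact: segment_connected.
Qed.

Lemma arc_betweenP T (A : set T) a b : arc_between A a b ->
  [/\ continuum A, A a, A b & a <> b].
Proof.
move=> [h [hh <- <-]]; have hA := homeomorphism_image hh.
split; first exact: arc_param_continuum hh.
- by rewrite -hA; exact: imageP zero_I01.
- by rewrite -hA; exact: imageP one_I01.
- move/(homeomorphism_inj hh zero_I01 one_I01) => /esym/eqP.
  by rewrite oner_eq0.
Qed.

Lemma arc_endpointP T (A : set T) t : arc_endpoint A t ->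
  exists2 x, arc_between A t x & t <> x.
Proof.
move=> [a [b [ab]]]; have [_ _ _ nab] := arc_betweenP ab.
by case=> ->; [exists b|exists a => //; [exact: arc_between_sym|exact/nesym]].
Qed.

Lemma arc_between_endpoint T (A : set T) a b : arc_between A a b -> arc_endpoint A a.
Proof. by move=> ab; exists a, b; split => //; left. Qed.

Lemma arc_between_arc T (A : set T) a b : arc_between A a b -> Defs.arc A.
Proof.
move=> [h [hh _ _]]; have [g [gh _ _]] := homeomorphism_inv hh.
by exists g.
Qed.

Lemma arc_between_connected_eq T (A S : set T) a b : arc_between A a b ->
  connected S -> S `<=` A -> S a -> S b -> S = A.
Proof.
move=> [h [hh <- <-]] cS SA Sa Sb; apply/seteqP; split => //.
by rewrite -(homeomorphism_image hh); apply: (connected_in_arc hh).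
Qed.

Lemma continuum_closed T (A : set T) : continuum A -> closed A.
Proof. by move=> [_ cA _]; apply: compact_closed cA; exact: metric_hausdorff. Qed.

Lemma continuumU T (A B : set T) : continuum A -> continuum B ->
  A `&` B !=set0 -> continuum (A `|` B).
Proof.
move=> [[a Aa] cA kA] [_ cB kB] AB; split.
- by exists a; left.
- exact: compactU.
- exact: connectedU.
Qed.

(** If the two continua meet, their union is a subcontinuum, and unicoherence of that union
    applies. *)
Lemma hereditarily_unicoherent_setI T (X A B : set T) :
  hereditarily_unicoherent X -> subcontinuum A X -> subcontinuum B X ->
  connected (A `&` B).
Proof.
move=> hX [AX cA] [BX cB].
have [AB|nAB] := pselect (A `&` B !=set0); last first.
  have -> : A `&` B = set0 by apply/seteqP; split => // x Ax; apply: nAB; exists x.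
  exact: connected0.
apply: (hX (A `|` B)) => //; split; last exact: continuumU.
by move=> x []; [exact: AX|exact: BX].
Qed.

Lemma subcontinuum_setI T (X A B : set T) :
  hereditarily_unicoherent X -> subcontinuum A X -> subcontinuum B X ->
  A `&` B !=set0 -> subcontinuum (A `&` B) X.
Proof.
move=> hX AX BX AB; split; first by move=> x [/(proj1 AX)].
split => //; last exact: hereditarily_unicoherent_setI hX AX BX.
apply: compact_closedI; first by case: AX => _ [].
by apply: continuum_closed; case: BX.
Qed.

(** The source of uniqueness of arcs: [A] meets [S] in a connected subset of an arc. *)
Lemma arc_sub_continuum T (X A S : set T) (h : R -> T) (a b : R) :
  hereditarily_unicoherent X -> homeomorphism I01 A h -> A `<=` X ->
  subcontinuum S X -> 0 <= a -> a <= b -> b <= 1 -> S (h a) -> S (h b) ->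
  h @` `[a, b] `<=` S.
Proof.
move=> hX hh AX SX a0 ab b1 Sa Sb.
have AX' : subcontinuum A X by split => //; exact: arc_param_continuum hh.
have Ah x : I01 x -> A (h x).
  by move=> Ix; rewrite -(homeomorphism_image hh); exact: imageP.
apply: subset_trans (@connected_in_arc _ A (A `&` S) _ _ _ hh _ _ a0 b1 _ _) _.
- exact: hereditarily_unicoherent_setI hX AX' SX.
- exact: subIsetl.
- by split => //; apply: Ah; rewrite /= in_itv /= a0 (le_trans ab).
- by split => //; apply: Ah; rewrite /= in_itv /= b1 (le_trans a0).
- exact: subIsetr.
Qed.

End Arcs.

(** * Separation by relatively clopen sets *)

Section CutWire.

(** The intersection property for downward directed families, the form in which compactness is used
    for separation, finite nets and uniform continuity. *)
Lemma compact_directed_meet (T : topologicalType) (F V : set T)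
    (E : set (set T)) :
  compact F -> closed V -> E !=set0 -> (forall D, E D -> closed D) ->
  (forall D1 D2, E D1 -> E D2 -> exists2 D, E D & D `<=` D1 `&` D2) ->
  (forall D, E D -> (F `&` D) `&` V !=set0) ->
  exists p, [/\ F p, V p & forall D, E D -> D p].
Proof.
move=> cF cV [D0 ED0] cE dE mE.
pose G := filter_from E (fun D => (F `&` D) `&` V).
have FG : ProperFilter G.
  apply: filter_from_proper; last by move=> D /mE.
  apply: filter_from_filter; first by exists D0.
  move=> D1 D2 E1 E2; have [D ED DD] := dE _ _ E1 E2.
  exists D => // x [[Fx Dx] Vx]; have [D1x D2x] := DD _ Dx.
  by split.
have [|p [Fp Gp]] := cF G FG; first by exists D0 => // x /= [[]].
exists p; split => //.
- apply: cV => B Bp; have [|x [Vx Bx]] := Gp V B _ Bp.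
    by exists D0 => // x /= [].
  by exists x.
- move=> D ED; apply: (cE _ ED) => B Bp.
  have [|x [Dx Bx]] := Gp D B _ Bp; first by exists D => // x /= [[]].
  by exists x.
Qed.

(** For closed [F] these are the relatively clopen subsets, phrased with closed sets of the whole
    space so that no subspace topology is needed. *)
Definition clopen_in (T : topologicalType) (F D : set T) :=
  [/\ D `<=` F, closed D & closed (F `\` D)].

Lemma clopen_inC (T : topologicalType) (F D : set T) :
  clopen_in F D -> clopen_in F (F `\` D).
Proof.
move=> [DF cD cFD]; split; [exact: subDsetl|by []|].
suff -> : F `\` (F `\` D) = D by [].
by rewrite setDD; apply/setIidPr.
Qed.

Lemma clopen_inI (T : topologicalType) (F D D' : set T) :
  clopen_in F D -> clopen_in F D' -> clopen_in F (D `&` D').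
Proof.
move=> [DF cD cFD] [DF' cD' cFD']; split.
- by move=> x [/DF].
- exact: closedI.
- by rewrite setDIr; exact: closedU.
Qed.

Context {R : realType} {T : metricType R}.
Implicit Types F A B : set T.

Lemma compact_disjoint_open_sep A B : compact A -> closed B -> A `&` B = set0 ->
  exists U V, [/\ open U, open V, A `<=` U, B `<=` V & U `&` V = set0].
Proof.
move=> cA cB AB.
have BN x : A x -> ~ B x by move=> Ax Bx; have : (A `&` B) x by []; rewrite AB.
(* Otherwise points of [A] arbitrarily near [B] accumulate at some [p] in [A], which has a ball
   missing the closed set [B]. *)
have [e e0 eP] : exists2 e : R, 0 < e & forall x y, A x -> B y -> e <= mdist x y.
  pose D (r : R) := [set x | forall y, B y -> r <= mdist x y].
  apply: contrapT => ne.
  pose E := [set D' | exists2 r, 0 < r & D' = closure [set x | A x /\ ~ D r x]].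
  have [|||D1 D2 [r1 r10 ->] [r2 r20 ->]|D' [r r0 ->]|p [Ap _ pE]] :=
    @compact_directed_meet _ A setT E cA.
  - exact: closedT.
  - by exists (closure [set x | A x /\ ~ D 1 x]); exists 1.
  - by move=> D' [r _ ->]; exact: closed_closure.
  - have rmin : 0 < Num.min r1 r2 by rewrite lt_min r10.
    exists (closure [set x | A x /\ ~ D (Num.min r1 r2) x]).
      by exists (Num.min r1 r2).
    rewrite subsetI; split; apply: closureS => x [Ax nD]; split => // h; apply: nD => y By.
      by rewrite ge_min h.
    by rewrite ge_min h ?orbT.
  - apply: contrapT => nE; apply: ne; exists r => // x y Ax.
    apply: contrapT => nxy; apply: nE; exists x; split => //; split => //.
    apply: subset_closure; split => // Dx; apply: nxy => ?; exact: Dx.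
  have [d d0 dB] := (closed_ballP B).1 cB p (BN _ Ap).
  have d20 : 0 < d / 2 by rewrite divr_gt0.
  have : closure [set x | A x /\ ~ D (d / 2) x] p by apply: pE; exists (d / 2).
  move=> /(_ _ (nbhsx_ballx p (d / 2) d20)) [x [[Ax nD]]].
  rewrite ballEmdist /= => xp; apply: nD => y By; rewrite leNgt; apply/negP => xy.
  apply: (dB y) => //; rewrite ballEmdist /=.
  by rewrite (le_lt_trans (metric_triangle p x y))// (splitr d) ltrD.
exists (\bigcup_(x in A) (ball x (e / 2))°), (\bigcup_(x in B) (ball x (e / 2))°).
have e20 : 0 < e / 2 by rewrite divr_gt0.
have sub (D : set T) : D `<=` \bigcup_(x in D) (ball x (e / 2))°.
  move=> x Dx; exists x => //; exact: nbhsx_ballx.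
split => //.
- by apply: bigcup_open => x _; exact: open_interior.
- by apply: bigcup_open => x _; exact: open_interior.
- apply/seteqP; split => // z [[x Ax /interior_subset]].
  rewrite ballEmdist /= => xz [y By /interior_subset]; rewrite ballEmdist /= => yz.
  have := eP x y Ax By; rewrite leNgt => /negP; apply.
  by rewrite (le_lt_trans (metric_triangle x z y))// (splitr e) ltrD// metric_sym.
Qed.

(** The set is the quasi-component of [b]; in a compact space quasi-components are connected. *)
Lemma quasicomponent_connected F b : compact F -> F b ->
  connected [set x | forall E, clopen_in F E -> E b -> E x].
Proof.
move=> cF Fb; set Q := [set x | _].
have clF : closed F by apply: compact_closed cF; exact: metric_hausdorff.
have FF : clopen_in F F by split => //; rewrite setDv; exact: closed0.
have QF : Q `<=` F by move=> x; exact.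
have cQ : closed Q.
  move=> x clx E cE Eb; have [_ cE' _] := cE; apply: cE' => B Bx.
  by have [y [Qy By]] := clx B Bx; exists y; split => //; exact: Qy.
(* A piece M of a separation of Q that contains b lies in a clopen set disjoint
   from the other piece N. *)
have key (M N : set T) : closed M -> closed N -> M `|` N = Q -> M `&` N = set0 ->
    M b -> N = set0.
  move=> cM cN MN MN0 Mb.
  have MF : M `<=` F by move=> x Mx; apply: QF; rewrite -MN; left.
  have [U [V [oU oV MU NV UV0]]] :=
    compact_disjoint_open_sep (subclosed_compact cM cF MF) cN MN0.
  (* If some clopen set around [b] lies in the union of [U] and [V], its part in [U] is again
     clopen. If none does, compactness gives a point of [Q] outside both, which is absurd. *)
  have [[E [cE Eb] EUV]|nE] :=
      pselect (exists2 E, clopen_in F E /\ E b & E `<=` U `|` V).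
    have EU : clopen_in F (E `&` U).
      have [EF clE clFE] := cE; split; first by move=> x [/EF].
      - suff -> : E `&` U = E `&` ~` V.
          by apply: closedI => //; exact: open_closedC.
        apply/seteqP; split => [x [Ex Ux]|x [Ex nVx]]; split => //.
          by move=> Vx; have : (U `&` V) x by []; rewrite UV0.
        by case: (EUV _ Ex).
      - by rewrite setDIr; apply: closedU => //; rewrite setDE; apply: closedI => //; exact: open_closedC.
    apply/seteqP; split => // x Nx.
    have Qx : Q x by rewrite -MN; right.
    have [_ Ux] := Qx _ EU (conj Eb (MU _ Mb)).
    suff : (U `&` V) x by rewrite UV0.
    by split => //; exact: NV.
  pose EE := [set E | clopen_in F E /\ E b].
  have [|||D1 D2 [c1 b1] [c2 b2]|D [cD Db]|p [Fp nUV pE]] :=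
    @compact_directed_meet _ F (~` (U `|` V)) EE cF.
  - by apply: open_closedC; exact: openU.
  - by exists F.
  - by move=> D [[]].
  - by exists (D1 `&` D2) => //; split => //; exact: clopen_inI.
  - apply: contrapT => nx; apply: nE; exists D => // x Dx; apply: contrapT => nUV.
    by apply: nx; exists x; split => //; split => //; case: cD => + _ _; exact.
  have : Q p by move=> E cE Eb; exact: pE.
  rewrite -MN; case=> [Mp|Np]; exfalso; apply: nUV.
    by left; exact: MU.
  by right; exact: NV.
move=> B [x Bx] [W oW BW] [C cC BC].
have cB : closed B by rewrite BC; exact: closedI.
have cQB : closed (Q `\` B).
  suff -> : Q `\` B = Q `&` ~` W by apply: closedI => //; exact: open_closedC.
  by rewrite BW setDIr setDv set0U setDE.
have BQ : B `<=` Q by rewrite BW; exact: subIsetl.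
have UB : B `|` Q `\` B = Q by apply/seteqP; split => [x' [/BQ//|[]//]|x' Qx']; have [Bx'|nBx'] := pselect (B x'); [left|right].
have IB : B `&` (Q `\` B) = set0 by rewrite setDE setICA setICr setI0.
have [Bb|nBb] := pselect (B b).
  by rewrite -[RHS]UB (key _ _ cB cQB UB IB Bb) setU0.
have : B = set0; last by move=> B0; rewrite B0 in Bx.
have UB' : (Q `\` B) `|` B = Q by rewrite setUC.
have IB' : (Q `\` B) `&` B = set0 by rewrite setIC.
by apply: (key _ _ cQB cB UB' IB'); split => // E.
Qed.

(** The cut-wire theorem. If no clopen set separates, compactness is used twice: for a [b] in [B]
    lying in every clopen set that contains [A], then for an [a] in [A] lying in every clopen set
    around [b]. The quasi-component of [b] then joins [A] to [B]. *)
Lemma cut_wire F A B : compact F -> closed A -> closed B ->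
  A `<=` F -> B `<=` F ->
  (forall S a b, connected S -> S `<=` F -> S a -> S b -> A a -> B b -> False) ->
  exists E, [/\ clopen_in F E, A `<=` E & E `&` B = set0].
Proof.
move=> cF cA cB AF BF h.
have clF : closed F by apply: compact_closed cF; exact: metric_hausdorff.
have FF : clopen_in F F by split => //; rewrite setDv; exact: closed0.
apply: contrapT => nE.
have [|||D1 D2 [c1 b1] [c2 b2]|D [cD Db]|b [Fb Bb bE]] :=
  @compact_directed_meet _ F B [set E | clopen_in F E /\ A `<=` E] cF.
- exact: cB.
- by exists F.
- by move=> D [[]].
- by exists (D1 `&` D2) => //; split; [exact: clopen_inI|rewrite subsetI].
- apply: contrapT => nx; apply: nE; exists D; split => //.
  by apply/seteqP; split => // x [Dx Bx]; apply: nx; exists x; split => //; split => //; exact: BF.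
have [|||D1 D2 [c1 b1] [c2 b2]|D [cD Db]|a [Fa Aa aE]] :=
  @compact_directed_meet _ F A [set E | clopen_in F E /\ E b] cF.
- exact: cA.
- by exists F.
- by move=> D [[]].
- by exists (D1 `&` D2) => //; split => //; exact: clopen_inI.
- apply: contrapT => nx.
  (* If [D] missed [A], its complement would be a clopen set containing [A], hence would contain
     [b]. *)
  have [] := bE (F `\` D); last by [].
  split; first exact: clopen_inC.
  move=> x Ax; split; first exact: AF.
  by move=> Dx; apply: nx; exists x; split => //; split => //; exact: AF.
apply: (h [set x | forall E, clopen_in F E -> E b -> E x] a b) => //.
- exact: quasicomponent_connected.
- by move=> x; exact.
- by move=> E cE Eb; exact: aE.
Qed.

End CutWire.

(** * The order of a dendroid with a base point *)

Section DendroidOrder.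
Context {R : realType} {T : metricType R}.
Local Notation I01 := (`[0, 1]%classic : set R).

(** The arc [t, x] as a function of x. Read [branch X t y x] as the relation x <= y of the dendroid
    rooted at [t]. *)
Definition branch (X : set T) (t x : T) : set T :=
  xget set0 [set A | is_dendroid_arc X t x A].

Context {X : set T} {t : T}.
Hypotheses (dX : dendroid X) (Xt : X t).
Local Notation br := (@branch X t).

Let hX : hereditarily_unicoherent X. Proof. by case: dX. Qed.

Lemma branchP x : X x -> is_dendroid_arc X t x (br x).
Proof.
move=> Xx; suff [A hA] : exists A, is_dendroid_arc X t x A by exact: (xgetI _ hA).
have [<-|tx] := pselect (t = x).
  by exists [set t]; split; [move=> _ ->|left].
have [_ /(_ t x Xt Xx tx) [A [AX tA]] _] := dX.
by exists A; split => //; right.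
Qed.

Lemma branch_top : br t = [set t].
Proof. by have [_ [[_ ->]|[]]] := branchP Xt. Qed.

Lemma branch_param x : X x -> x <> t -> exists h : R -> T,
  [/\ homeomorphism I01 (br x) h, h 0 = t & h 1 = x].
Proof. by move=> Xx xt; have [_ [[tx]|[_ hh]]] := branchP Xx; first exfalso; auto. Qed.

Lemma branch_subcontinuum x : X x -> [/\ subcontinuum (br x) X, br x t & br x x].
Proof.
move=> Xx; have [sX [[tx ->]|[_ /arc_betweenP [? ? ?]]]] := branchP Xx => //.
rewrite -tx; split => //; split; first by move=> _ ->.
by split; [exists t|exact: compact_set1|exact: connected1].
Qed.

Lemma branch_sub x : X x -> br x `<=` X.
Proof. by move=> /branch_subcontinuum[[]]. Qed.

Lemma branch_closed x : X x -> closed (br x).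
Proof. by move=> /branch_subcontinuum[[_ /continuum_closed]]. Qed.

Lemma branch_refl x : X x -> br x x.
Proof. by move=> /branch_subcontinuum[]. Qed.

Lemma branch_top_mem x : X x -> br x t.
Proof. by move=> /branch_subcontinuum[]. Qed.

(** Minimality makes [t, x] independent of the choice made and the order transitive. *)
Lemma branch_min x S : X x -> subcontinuum S X -> S t -> S x -> br x `<=` S.
Proof.
move=> Xx SX St Sx; have [->|xt] := pselect (x = t); first by rewrite branch_top => _ ->.
have [h [hh h0 h1]] := branch_param Xx xt.
rewrite -(homeomorphism_image hh).
by apply: (arc_sub_continuum hX hh (branch_sub Xx) SX); rewrite ?h0 ?h1// ler01.
Qed.

Lemma branch_trans x y : X x -> br x y -> br y `<=` br x.
Proof.
move=> Xx xy; have [sx st _] := branch_subcontinuum Xx.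
by apply: branch_min => //; exact: (branch_sub Xx).
Qed.

(** Initial pieces of a branch are themselves branches, so a parametrization carries the order of
    the unit interval to that of the branch. *)
Lemma branch_paramE x h s : X x -> homeomorphism I01 (br x) h -> h 0 = t ->
  0 <= s <= 1 -> br (h s) = h @` `[0, s].
Proof.
move=> Xx hh h0 /andP[s0 s1].
have [->|sn0] := eqVneq s 0.
  rewrite h0 branch_top; apply/seteqP; split => [_ ->|].
    by exists 0; rewrite //= in_itv /= lexx.
  by move=> y [r /=]; rewrite in_itv /= => /le_anti <- <-; rewrite h0.
have sp : 0 < s by rewrite lt_neqAle eq_sym sn0.
have Is : I01 s by rewrite /= in_itv /= s0.
have hA r : I01 r -> br x (h r).
  by move=> Ir; rewrite -(homeomorphism_image hh); exact: imageP.
have Xhs : X (h s) by apply: (branch_sub Xx); exact: hA.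
have arcs : arc_between (h @` `[0, s]) (h 0) (h s) by apply: (subarc hh).
have [cs hs0 hss _] := arc_betweenP arcs.
rewrite h0 in hs0; apply/seteqP; split.
  apply: branch_min => //; split => // _ [r rs <-]; apply: (branch_sub Xx); apply: hA.
  by move: rs; rewrite /= !in_itv /= => /andP[-> /le_trans ->].
have [sc st sx] := branch_subcontinuum Xhs.
by apply: (arc_sub_continuum hX hh (branch_sub Xx) sc); rewrite ?h0.
Qed.

Lemma branch_memP x h y : X x -> homeomorphism I01 (br x) h -> br x y ->
  exists2 s, 0 <= s <= 1 & h s = y.
Proof.
move=> Xx hh; rewrite -{1}(homeomorphism_image hh) => -[s + <-].
by rewrite /= in_itv /= => ?; exists s.
Qed.

Lemma branch_param_mem x h r s : X x -> homeomorphism I01 (br x) h -> h 0 = t ->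
  0 <= r <= 1 -> 0 <= s <= 1 -> br (h s) (h r) -> r <= s.
Proof.
move=> Xx hh h0 /andP[r0 r1] /andP[s0 s1].
rewrite (branch_paramE Xx hh h0) ?s0// => -[q]; rewrite /= in_itv /= => /andP[q0 qs].
move=> /(homeomorphism_inj hh) <- //.
- by rewrite /= in_itv /= q0 (le_trans qs).
- by rewrite /= in_itv /= r0.
Qed.

Lemma branch_anti x y : X x -> br x y -> br y x -> x = y.
Proof.
move=> Xx xy yx; have [xt|xt] := pselect (x = t).
  by move: xy; rewrite xt branch_top => ->.
have [h [hh h0 h1]] := branch_param Xx xt.
have [s s01 hs] := branch_memP Xx hh xy.
rewrite -h1 -hs in yx *; congr h; apply: le_anti.
by rewrite (branch_param_mem Xx hh h0 _ s01 yx) ?lexx ?ler01//; case/andP: s01.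
Qed.

Lemma branch_interval_connected x y : X y -> br y x -> exists C,
  [/\ connected C, C x, C y & forall z, C z -> br y z /\ br z x].
Proof.
move=> Xy yx; have [yt|yt] := pselect (y = t).
  move: yx; rewrite yt branch_top => ->; exists [set t]; split => //.
    exact: connected1.
  by move=> _ ->; split => //; exact: branch_refl.
have [h [hh h0 h1]] := branch_param Xy yt.
have [s s01 hs] := branch_memP Xy hh yx; case/andP: (s01) => s0 s1.
have sub : `[s, 1] `<=` I01.
  by move=> r; rewrite /= !in_itv /= => /andP[/(le_trans s0) -> ->].
exists (h @` `[s, 1]); split.
- apply: connected_continuous_connected; first exact: segment_connected.
  by apply: continuous_subspaceW (homeomorphism_continuous hh).
- by exists s; rewrite //= in_itv /= lexx.
- by exists 1; rewrite //= in_itv /= s1 lexx.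
- move=> _ [r sr <-]; have Ir := sub _ sr; split.
    by rewrite -(homeomorphism_image hh); exact: imageP.
  rewrite (branch_paramE Xy hh h0) ?Ir//; exists s => //.
  by move: sr; rewrite /= !in_itv /= s0 => /andP[].
Qed.

(* The last common point of two branches is the endpoint of three arcs, so it
   is the top of the fan. *)
Lemma fan_branch_setI x y : ramification_points X = [set t] -> X x -> X y ->
  ~ br x y -> ~ br y x -> br x `&` br y = [set t].
Proof.
move=> rX Xx Xy nxy nyx.
have xt : x <> t by move=> xt; apply: nyx; rewrite xt; exact: branch_top_mem.
have yt : y <> t by move=> yt; apply: nxy; rewrite yt; exact: branch_top_mem.
have [h [hh h0 h1]] := branch_param Xx xt.
have [g [gg g0 g1]] := branch_param Xy yt.
have [sx _ _] := branch_subcontinuum Xx; have [sy _ _] := branch_subcontinuum Xy.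
set I := br x `&` br y.
have It : I t by split; exact: branch_top_mem.
have [] : subcontinuum I X by apply: subcontinuum_setI => //; exists t.
move=> IX [_ cI _].
pose J := [set s : R | 0 <= s <= 1 /\ br y (h s)].
have JI : exists2 m, J m & forall s, J s -> s <= m.
  have [k [kk kh hk]] := homeomorphism_inv hh.
  have -> : J = k @` I.
    apply/seteqP; split => [s [s01 ys]|_ [z [xz yz] <-]].
      have Is : I01 s by rewrite /= in_itv.
      exists (h s); last exact: kh.
      by split => //; rewrite -(homeomorphism_image hh); exact: imageP.
    split; last by rewrite hk.
    by have [s s01 <-] := branch_memP Xx hh xz; rewrite kh// /= in_itv.
  have kI : {within I, continuous k}.
    by apply: continuous_subspaceW (homeomorphism_continuous kk) => z [].
  have [|||m mkI mmax] := @compact_EVT_max _ R id (k @` I).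
  - by exists (k t); exact: imageP.
  - by apply: continuous_compact.
  - by apply: continuous_subspaceT => z; exact: cvg_id.
  - by exists m => [|s kIs]; [exact/set_mem|apply: mmax; exact/mem_set].
case: JI => m [m01 ym] mmax; case/andP: (m01) => m0 m1.
have mx : m < 1.
  rewrite lt_neqAle m1 andbT; apply/eqP => m1'.
  by apply: nyx; rewrite -h1 -m1'.
have Imh : h @` `[m, 1] `&` br y = [set h m].
  apply/seteqP; split => [z [[s /=]]|z ->]; last first.
    by split => //; exists m; rewrite //= in_itv /= lexx.
  rewrite in_itv /= => /andP[ms s1] <- ys; congr h; apply: le_anti.
  by rewrite ms mmax//; split => //; rewrite s1 (le_trans m0).
have [n n01 gn] := branch_memP Xy gg ym; case/andP: (n01) => n0 n1.
have ny : n < 1.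
  rewrite lt_neqAle n1 andbT; apply/eqP => n1'.
  apply: nxy; rewrite -g1 -n1' gn -(homeomorphism_image hh).
  by apply: imageP; rewrite /= in_itv /= m0.
have [m0'|mn0] := eqVneq m 0.
  apply/seteqP; split => [z [xz yz]|_ ->//].
  have [s s01 hs] := branch_memP Xx hh xz.
  have : s <= m by apply: mmax; split => //; rewrite hs.
  rewrite m0'; case/andP: s01 => s0 _ sm; rewrite -hs /= -h0; congr h.
  by apply: le_anti; rewrite sm.
exfalso.
have mp : 0 < m by rewrite lt_neqAle eq_sym mn0.
have np : 0 < n.
  rewrite lt_neqAle n0 andbT eq_sym; apply/eqP => nn0; move/eqP: mn0; apply.
  apply: (homeomorphism_inj hh); rewrite /= ?in_itv /= ?lexx ?ler01 ?m0//.
  by rewrite -gn nn0 g0 h0.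
(* The part below [h m] is an initial piece of both branches. Read along [g], it is seen to meet the
   third arc only in [h m]. *)
have hbr : br (h m) = h @` `[0, m] by exact: branch_paramE hh h0 m01.
have gbr : br (h m) = g @` `[0, n] by rewrite -gn; exact: branch_paramE gg g0 n01.
have : ramification_points X (h m).
  have hx r : 0 <= r <= 1 -> br x (h r).
    by move=> r01; rewrite -(homeomorphism_image hh); apply: imageP; rewrite /= in_itv.
  have gy r : 0 <= r <= 1 -> br y (g r).
    by move=> r01; rewrite -(homeomorphism_image gg); apply: imageP; rewrite /= in_itv.
  have A1 : arc_between (h @` `[0, m]) (h 0) (h m) by apply: (subarc hh).
  have A2 : arc_between (h @` `[m, 1]) (h m) (h 1) by apply: (subarc hh).
  have A3 : arc_between (g @` `[n, 1]) (g n) (g 1) by apply: (subarc gg).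
  have gyn : g @` `[n, 1] `<=` br y.
    move=> _ [r /= + <-]; rewrite in_itv /= => /andP[nr r1].
    by apply: gy; rewrite r1 (le_trans n0).
  exists (h @` `[0, m]), (h @` `[m, 1]), (g @` `[n, 1]); split; split.
  - move=> _ [r /= + <-]; rewrite in_itv /= => /andP[r0 rm].
    by apply: (branch_sub Xx); apply: hx; rewrite r0 (le_trans rm).
  - move=> _ [r /= + <-]; rewrite in_itv /= => /andP[mr r1].
    by apply: (branch_sub Xx); apply: hx; rewrite r1 (le_trans m0).
  - by move=> z /gyn; exact: branch_sub.
  - by apply: arc_between_endpoint; apply: arc_between_sym A1.
  - exact: arc_between_endpoint A2.
  - by rewrite -gn; exact: arc_between_endpoint A3.
  - apply/seteqP; split => [_ [[r /= + <-] [r' /= +]]|_ ->]; last first.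
      by split; exists m; rewrite //= in_itv /= ?m0 ?m1 lexx.
    rewrite !in_itv /= => /andP[r0 rm] /andP[mr' r1'].
    move=> /(homeomorphism_inj hh) rr; congr h; apply: le_anti; rewrite rm /= -rr//.
    + by rewrite /= in_itv /= r1' (le_trans m0).
    + by rewrite /= in_itv /= r0 (le_trans rm).
  - rewrite -hbr gbr -gn; apply/seteqP; split => [_ [[r /= + <-] [r' /= +]]|_ ->]; last first.
      by split; exists n; rewrite //= in_itv /= ?n0 ?n1 lexx.
    rewrite !in_itv /= => /andP[r0 rm] /andP[mr' r1'].
    move=> /(homeomorphism_inj gg) rr; congr g; apply: le_anti; rewrite rm /= -rr//.
    + by rewrite /= in_itv /= r1' (le_trans n0).
    + by rewrite /= in_itv /= r0 (le_trans rm).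
  - rewrite -Imh; apply/seteqP; split => [z [? /gyn]//|z zI].
    split; first by case: zI.
    move: zI; rewrite Imh => ->; exists n => //.
    by rewrite /= in_itv /= lexx.
rewrite rX => /= hmt; move/eqP: mn0; apply.
by apply: (homeomorphism_inj hh); rewrite /= ?in_itv /= ?lexx ?ler01 ?m0// hmt.
Qed.

End DendroidOrder.

(** * Coordinates on a smooth fan *)

Section Distances.
Context {R : realType} {T : metricType R}.
Implicit Types A B : set T.

Definition infdist (p : T) A : R := inf [set mdist p a | a in A].

Lemma infdist_le p A a : A a -> infdist p A <= mdist p a.
Proof.
move=> Aa; apply: ge_inf; last exact: imageP.
by exists 0 => _ [b _ <-]; exact: mdist_ge0.
Qed.

Lemma le_infdist p A r : A !=set0 -> (forall a, A a -> r <= mdist p a) ->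
  r <= infdist p A.
Proof.
move=> [a Aa] h; apply: lb_le_inf; first by exists (mdist p a); exact: imageP.
by move=> _ [b Ab <-]; exact: h.
Qed.

Lemma infdist_ge0 p A : A !=set0 -> 0 <= infdist p A.
Proof. by move=> A0; apply: le_infdist => // a _; exact: mdist_ge0. Qed.

Lemma infdistS p A B : A !=set0 -> A `<=` B -> infdist p B <= infdist p A.
Proof. by move=> A0 AB; apply: le_infdist => // a /AB; exact: infdist_le. Qed.

(** One half of the fact that the distance from [p] to a set is 1-Lipschitz for the Hausdorff
    metric. *)
Lemma infdist_neighborhood p A B r : B !=set0 -> B `<=` metric_neighborhood r A ->
  infdist p A <= infdist p B + r.
Proof.
move=> B0 BA; rewrite -lerBlDr; apply: le_infdist => // b /BA[a Aa ab].
rewrite lerBlDr; apply: (le_trans (infdist_le p Aa)).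
by apply: (le_trans (metric_triangle p b a)); rewrite lerD2l metric_sym ltW.
Qed.

Lemma mdist_continuous (p : T) : continuous (mdist p : T -> R).
Proof.
move=> x; apply/cvgrPdist_lt => e e0; apply/nbhs_ballP; exists e => // y.
rewrite ballEmdist /= => xy.
have := metric_triangle p x y; have := metric_triangle p y x.
by rewrite (metric_sym y x) ltr_norml => h1 h2; apply/andP; split; lra.
Qed.

Lemma compact_mdist_bounded A : compact A ->
  exists2 M : R, 0 < M & forall x y, A x -> A y -> mdist x y < M.
Proof.
move=> cA; have [[a Aa]|A0] := pselect (A !=set0); last first.
  by exists 1 => // x y Ax; exfalso; apply: A0; exists x.
have [||c Ac cmax] := @compact_EVT_max _ R (mdist a) A _ cA.
- by exists a.
- by apply: continuous_subspaceT; exact: mdist_continuous.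
exists (2 * mdist a c + 1); first by rewrite ltr_pwDr// mulr_ge0// mdist_ge0.
move=> x y /mem_set/cmax ax /mem_set/cmax ay.
have := metric_triangle x a y; rewrite (metric_sym x a); lra.
Qed.

Lemma hausdorff_dist_lt A B r : A !=set0 -> B !=set0 -> compact A -> compact B ->
  hausdorff_dist A B < r ->
  A `<=` metric_neighborhood r B /\ B `<=` metric_neighborhood r A.
Proof.
move=> [a Aa] [b Bb] cA cB; rewrite /hausdorff_dist => /inf_lt.
(* An infimum is approximated by members only if there are any; the bound [M] on all distances is an
   admissible radius. *)
have [M M0 MP] := compact_mdist_bounded (compactU cA cB).
case=> [|s [s0 AB BA] sr].
  exists M; split => // x xA; [exists b|exists a] => //; apply: MP;
    by [left|right].
by split => x; [move=> /AB[y By yx]|move=> /BA[y Ay yx]]; exists y => //; exact: lt_trans sr.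
Qed.

Lemma compact_dense_sequence A : A !=set0 -> compact A ->
  exists p : nat -> T, (forall n, A (p n)) /\
    forall x e, A x -> 0 < e -> exists n, mdist (p n) x < e.
Proof.
move=> [a Aa] cA.
have net (k : nat) : exists s : seq T,
    (forall x, x \in s -> A x) /\
    forall x, A x -> exists2 y, y \in s & mdist y x < k.+1%:R^-1.
  apply: contrapT => nnet.
  (* [C s] is what the balls around [s] leave uncovered. A point common to all [C s] would be
     uncovered by its own ball. *)
  pose C (s : seq T) := A `&` ~` \bigcup_(y in [set y | y \in s]) (ball y k.+1%:R^-1)°.
  have clA : closed A by apply: compact_closed cA; exact: metric_hausdorff.
  have [|||||p [Ap _ pE]] := @compact_directed_meet _ A A
    [set D | exists2 s : seq T, (forall x, x \in s -> A x) & D = C s] cA.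
  - exact: clA.
  - by exists (C [::]), [::].
  - move=> _ [s _ ->]; apply: closedI => //; apply: open_closedC.
    by apply: bigcup_open => y _; exact: open_interior.
  - move=> _ _ [s1 s1A ->] [s2 s2A ->]; exists (C (s1 ++ s2)).
      by exists (s1 ++ s2) => // x; rewrite mem_cat => /orP[/s1A|/s2A].
    move=> x [Ax nx]; split; split => // -[y /= ys xy]; apply: nx; exists y => //=;
      by rewrite mem_cat ys ?orbT.
  - move=> _ [s sA ->]; apply: contrapT => nC; apply: nnet; exists s; split => // x Ax.
    apply: contrapT => nx; apply: nC; exists x; split => //; split => //; split => //.
    move=> [y /= ys /interior_subset]; rewrite ballEmdist /= => yx.
    by apply: nx; exists y.
  - have [|_] := pE (C [:: p]).
      by exists [:: p] => // x; rewrite inE => /eqP ->.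
    by apply; exists p; [rewrite /= inE|exact: nbhsx_ballx].
pose s k := sval (cid (net k)).
have sP k : (forall x, x \in s k -> A x) /\
    forall x, A x -> exists2 y, y \in s k & mdist y x < k.+1%:R^-1.
  exact: svalP (cid (net k)).
(* The code [n] names the i-th point of the k-th net; codes that name no point yield [a]. *)
exists (fun n => if (unpickle n : option (nat * nat)) is Some ki
                 then nth a (s ki.1) ki.2 else a); split.
  move=> n; case: unpickle => // -[k i] /=.
  have [is_|si] := ltnP i (size (s k)); last by rewrite nth_default.
  by apply: (sP k).1; exact: mem_nth.
move=> x e Ax e0; have [k _ ke] := near_infty_natSinv_lt (PosNum e0).
have [y ys yx] := (sP k).2 _ Ax.
exists (pickle (k, index y (s k))); rewrite pickleK /= nth_index//.
by apply: lt_trans yx _; apply: (ke k) => /=.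
Qed.

End Distances.

(** * Weighted sums of uniformly bounded functions *)

Section WeightedSum.
Context {R : realType} {T : pseudoMetricType R}.
Variables (Z : set T) (u : nat -> T -> R) (M : R).
Hypothesis uM : forall k x, Z x -> 0 <= u k x <= M.

Let S (n : nat) (x : T) : R := \sum_(k < n) u k x / 2 ^+ k.

Let SS n x : S n.+1 x = S n x + u n x / 2 ^+ n.
Proof. by rewrite /S big_ord_recr. Qed.

Let p2 n : 0 < 2 ^+ n :> R. Proof. by rewrite exprn_gt0. Qed.

Let S_le m n x : Z x -> (m <= n)%N -> S m x <= S n x.
Proof.
move=> Zx /subnK <-; elim: (n - m)%N => // k IH.
rewrite addSn SS (le_trans IH)// lerDl divr_ge0 ?(ltW (p2 _))//.
by case/andP: (uM (k + m) Zx).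
Qed.

Let S_bound m n x : Z x -> S m x <= S n x + 2 * M / 2 ^+ n.
Proof.
move=> Zx; have M0 : 0 <= M by case/andP: (uM 0 Zx) => /le_trans; apply.
have [mn|/ltnW nm] := leqP m n.
  by rewrite (le_trans (S_le Zx mn))// lerDl divr_ge0 ?mulr_ge0 ?(ltW (p2 _)).
(* The partial sum plus the tail bound 2M / 2^m is non-increasing in m. *)
have tail : S m x + 2 * M / 2 ^+ m <= S n x + 2 * M / 2 ^+ n.
  rewrite -(subnK nm); elim: (m - n)%N => // k IH.
  rewrite addSn SS (le_trans _ IH)// -addrA lerD2l.
  case/andP: (uM (k + n) Zx) => u0 u1.
  rewrite exprS invfM mulrA -mulrDl ler_pM2r ?invr_gt0//.
  by rewrite mulrAC divff// mul1r; lra.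
by rewrite (le_trans _ tail)// lerDl divr_ge0 ?mulr_ge0 ?(ltW (p2 _)).
Qed.

(** The terms are nonnegative, so the sum can be taken as the supremum of the partial sums; the
    geometric tail makes the convergence uniform. *)
Lemma weighted_sum : exists F : T -> R,
  [/\ (forall k, {within Z, continuous (u k)}) -> {within Z, continuous F},
      (forall x, Z x -> 0 <= F x <= 2 * M),
      (forall x y, Z x -> Z y -> (forall k, u k x <= u k y) -> F x <= F y)
    & (forall x y j, Z x -> Z y -> (forall k, u k x <= u k y) -> u j x < u j y ->
        F x < F y)].
Proof.
pose F x := sup (range (S^~ x)).
have ubF x : Z x -> has_sup (range (S^~ x)).
  move=> Zx; split; first by exists (S 0 x); exists 0%N.
  by exists (S 0 x + 2 * M / 2 ^+ 0) => _ [m _ <-]; exact: S_bound.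
have SF n x : Z x -> S n x <= F x.
  by move=> Zx; apply: ub_le_sup; [case: (ubF x Zx)|exists n].
have FS x r : Z x -> (forall n, S n x <= r) -> F x <= r.
  move=> Zx h; apply: ge_sup; first by case: (ubF x Zx).
  by move=> _ [n _ <-].
have S0 x : S 0 x = 0 by rewrite /S big_ord0.
exists F; split.
- move=> cu.
  have cS n : {within Z, continuous (S n)}.
    elim: n => [|n IH].
      rewrite (_ : S 0 = cst 0); last by apply/funext => x; exact: S0.
      by apply: continuous_subspaceT => x; exact: cvg_cst.
    rewrite (_ : S n.+1 = (fun x => S n x + u n x * (2 ^+ n)^-1)); last first.
      by apply/funext => x; exact: SS.
    move=> x; apply: cvgD; first exact: IH.
    by apply: cvgM; [exact: cu|exact: cvg_cst].
  apply/within_ballP => x Zx e e0.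
  (* The summand 1 keeps the divisor positive when [M] is 0. *)
  have M1 : 0 < 2 * M + 1.
    by rewrite ltr_pwDr// mulr_ge0//; case/andP: (uM 0 Zx) => /le_trans; apply.
  have e1 : 0 < e / (2 * (2 * M + 1)) by rewrite divr_gt0// mulr_gt0.
  have [n _ /(_ n (leqnn n)) /= ne] := near_infty_natSinv_expn_lt (PosNum e1).
  have tail : 2 * M / 2 ^+ n < e / 2.
    apply: (@le_lt_trans _ _ ((2 * M + 1) * (1 / 2 ^+ n))).
      by rewrite div1r ler_pM2r ?invr_gt0// lerDl.
    rewrite (_ : e / 2 = (2 * M + 1) * (e / (2 * (2 * M + 1)))).
      by rewrite ltr_pM2l.
    by field; rewrite gt_eqF.
  have e2 : 0 < e / 2 by rewrite divr_gt0.
  have [d d0 dP] := (within_ballP _ _).1 (cS n) x Zx _ e2.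
  exists d => // y Zy xy; have := dP y Zy xy.
  rewrite -!ball_normE /ball_ /= => Sxy.
  have := FS x _ Zx (fun m => S_bound m n Zx).
  have := FS y _ Zy (fun m => S_bound m n Zy).
  have := SF n x Zx; have := SF n y Zy.
  move: Sxy; rewrite !ltr_norml => /andP[? ?] ? ? ? ?; apply/andP; split; lra.
- move=> x Zx; rewrite -{1}(S0 x) SF//=; apply: FS => // n.
  by rewrite (le_trans (S_bound n 0 Zx))// S0 expr0 divr1 add0r.
- move=> x y Zx Zy xy; apply: FS => // n; apply: le_trans (SF n y Zy).
  by apply: ler_sum => k _; rewrite ler_pM2r ?invr_gt0.
- move=> x y j Zx Zy xy xyj.
  (* The gap at index [j] survives in every partial sum that includes [j], hence the maximum with
     [j.+1] below. *)
  apply: (@lt_le_trans _ _ (F x + (u j y - u j x) / 2 ^+ j)).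
    by rewrite ltrDl divr_gt0// subr_gt0.
  rewrite -lerBrDr; apply: FS => // n; rewrite lerBrDr.
  apply: le_trans (SF (maxn n j.+1) y Zy).
  apply: (@le_trans _ _ (S (maxn n j.+1) x + (u j y - u j x) / 2 ^+ j)).
    by rewrite lerD2r S_le// leq_maxl.
  have jm : (j < maxn n j.+1)%N by exact: leq_maxr.
  rewrite -lerBrDl -sumrB (bigD1 (Ordinal jm))//= -mulrBl lerDl.
  by apply: sumr_ge0 => k _; rewrite -mulrBl divr_ge0 ?subr_ge0 ?(ltW (p2 _)).
Qed.

End WeightedSum.

(** * Height and itinerary on a smooth fan *)

Section SmoothFanCoordinates.
Context {R : realType} {T : metricType R}.
Variables (Z : set T) (t : T).
Hypothesis fanZ : fan_with_top Z t.
Hypothesis smoothZ : forall (x_ : nat -> T) (x : T) (A_ : nat -> set T) (A : set T),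
  (forall n, Z (x_ n)) -> Z x -> x_ @ \oo --> x ->
  (forall n, is_dendroid_arc Z t (x_ n) (A_ n)) ->
  is_dendroid_arc Z t x A ->
  (fun n => hausdorff_dist (A_ n) A) @ \oo --> (0 : R).

Let dZ : dendroid Z. Proof. by case: fanZ. Qed.
Let rZ : ramification_points Z = [set t]. Proof. by case: fanZ. Qed.
Let hZ : hereditarily_unicoherent Z. Proof. by case: dZ. Qed.
Let cZ : continuum Z. Proof. by case: dZ. Qed.
Let kZ : compact Z. Proof. by case: cZ. Qed.
Let clZ : closed Z. Proof. exact: continuum_closed. Qed.
Let Zt : Z t.
Proof.
have : ramification_points Z t by rewrite rZ.
move=> [A [B [C [[AZ _ _] _ [AB _ _]]]]]; apply: AZ.
suff [] : (A `&` B) t by [].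
by rewrite AB.
Qed.

Local Notation br := (branch Z t).
Let comparable x y := br x y \/ br y x.

(** Smoothness enters here: the branches of a convergent sequence converge in the Hausdorff metric,
    on which the distance to [p] depends continuously. *)
Lemma infdist_branch_continuous p :
  {within Z, continuous (fun x => infdist p (br x))}.
Proof.
apply: within_seqP => u x Zx Zu ux e e0.
have br0 y : Z y -> br y !=set0.
  by move=> Zy; exists t; exact: (branch_top_mem dZ Zt Zy).
have brk y : Z y -> compact (br y).
  by move=> Zy; have [[_ []]] := branch_subcontinuum dZ Zt Zy.
have := smoothZ Zu Zx ux (fun n => branchP dZ Zt (Zu n)) (branchP dZ Zt Zx).
have e20 : 0 < e / 2 by rewrite divr_gt0.
move=> /cvgrPdist_lt /(_ _ e20)[n _ /(_ n (leqnn n))] /=.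
rewrite distrC subr0 => /(le_lt_trans (ler_norm _)) hn; exists n.
have [nx xn] := hausdorff_dist_lt (br0 _ (Zu n)) (br0 _ Zx) (brk _ (Zu n)) (brk _ Zx) hn.
have := infdist_neighborhood p (br0 _ (Zu n)) nx.
have := infdist_neighborhood p (br0 _ Zx) xn.
by rewrite -ball_normE /ball_ /= ltr_norml => ? ?; apply/andP; split; lra.
Qed.

Lemma smooth_fan_height : exists f : T -> R,
  [/\ {within Z, continuous f}, f t = 0,
      (forall x, Z x -> 0 <= f x <= 1)
    & (forall x y, Z y -> br y x -> x <> y -> f x < f y)].
Proof.
have [p [Zp pd]] := compact_dense_sequence (ex_intro _ t Zt) kZ.
have [M M0 MP] := compact_mdist_bounded kZ.
have br0 y : Z y -> br y !=set0.
  by move=> Zy; exists t; exact: (branch_top_mem dZ Zt Zy).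
have uM k x : Z x -> 0 <= infdist (p k) (br x) <= M.
  move=> Zx; rewrite (infdist_ge0 _ (br0 _ Zx))/=.
  apply: le_trans (infdist_le _ (branch_top_mem dZ Zt Zx)) _.
  by apply/ltW/MP => //; exact: Zp.
have [F [cF Fb Fm Fs]] := weighted_sum uM.
have {}cF := cF (fun k => @infdist_branch_continuous (p k)).
have uS k x y : Z y -> br y x -> infdist (p k) (br y) <= infdist (p k) (br x).
  move=> Zy yx; have Zx := branch_sub dZ Zt Zy yx.
  by apply: infdistS; [exact: br0|exact: (branch_trans dZ Zt)].
have MM0 : 0 < 2 * M by rewrite mulr_gt0.
(* Branches grow along a leg, so [F] decreases from its maximum at [t]; as [F] lies between 0 and
   2M, the quotient lies between 0 and 1. *)
exists (fun x => (F t - F x) / (2 * M)); split.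
- move=> x; apply: cvgM; last exact: cvg_cst.
  by apply: cvgB; [exact: cvg_cst|exact: cF].
- by rewrite subrr mul0r.
- move=> x Zx; rewrite divr_ge0 ?(ltW MM0) ?subr_ge0//=.
    rewrite ler_pdivrMr// mul1r.
    by case/andP: (Fb t Zt); case/andP: (Fb x Zx); lra.
  apply: Fm => // k; apply: uS => //; exact: (branch_top_mem dZ Zt Zx).
- move=> x y Zy yx xy; rewrite ltr_pM2r ?invr_gt0// ltrD2l ltrN2.
  have Zx := branch_sub dZ Zt Zy yx.
  have nxy : ~ br x y by move=> xy'; apply: xy; exact: (branch_anti dZ Zt Zx).
  (* The ball of radius [e] around [y] misses [t, x]. A [p k] within e/2 of [y] is closer than e/2
     to [t, y], but at least e/2 away from [t, x]. *)
  have [e e0 eP] := (closed_ballP _).1 (branch_closed dZ Zt Zx) _ nxy.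
  have e2 : 0 < e / 2 by rewrite divr_gt0.
  have [k pk] := pd _ _ Zy e2.
  apply: (Fs _ _ k) => // [j|]; first exact: uS.
  apply: le_lt_trans (infdist_le _ (branch_refl dZ Zt Zy)) _.
  apply: (lt_le_trans pk); apply: le_infdist; first exact: br0.
  move=> a xa; rewrite leNgt; apply/negP => pa; apply: (eP a) => //.
  rewrite ballEmdist /= (le_lt_trans (metric_triangle y (p k) a))//.
  by rewrite metric_sym; lra.
Qed.

(** The two branches meet only in [t]. If [K] misses [t], they split the intersection of [K] with
    their union, which hereditary unicoherence makes connected. *)
Lemma subcontinuum_incomparable K x y : subcontinuum K Z -> K x -> K y ->
  ~ comparable x y -> K t.
Proof.
move=> KZ Kx Ky nxy; apply: contrapT => nKt.
have Zx := (proj1 KZ) _ Kx; have Zy := (proj1 KZ) _ Ky.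
have [sx xt xx] := branch_subcontinuum dZ Zt Zx.
have [sy yt yy] := branch_subcontinuum dZ Zt Zy.
have sxy : subcontinuum (br x `|` br y) Z.
  split; first by move=> z [/(proj1 sx)|/(proj1 sy)].
  by apply: continuumU; [case: sx|case: sy|exists t].
have I : br x `&` br y = [set t].
  by apply: (fan_branch_setI dZ Zt rZ Zx Zy) => ?; apply: nxy; [left|right].
have cK := hereditarily_unicoherent_setI hZ KZ sxy.
have BE : K `&` (br x `|` br y) `&` br x = K `&` (br x `|` br y).
  apply: cK.
  - by exists x; split => //; split => //; left.
  - exists (~` br y); first by apply: closed_openC; exact: (branch_closed dZ Zt).
    apply/seteqP; split => [z [[Kz xyz] xz]|z [[Kz []//]]]; split => //.
      by move=> yz; apply: nKt; have : (br x `&` br y) z by []; rewrite I => <-.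
    by split => //; left.
  - by exists (br x) => //; exact: (branch_closed dZ Zt).
have [_ xy] : (K `&` (br x `|` br y) `&` br x) y.
  by rewrite BE; split => //; right.
by apply: nxy; left.
Qed.

Variable f : T -> R.
Hypotheses (cf : {within Z, continuous f}) (ft : f t = 0).
Hypothesis f_mono : forall x y, Z y -> br y x -> x <> y -> f x < f y.

(** Compact sets that avoid [t] and exhaust the rest of Z. *)
Let F (n : nat) := [set x | Z x /\ n.+1%:R^-1 <= f x].

Let f_near x e : Z x -> 0 < e ->
  exists2 d, 0 < d & forall y, Z y -> ball x d y -> `|f x - f y| < e.
Proof.
move=> Zx e0; have [d d0 dP] := (within_ballP _ _).1 cf x Zx e e0.
by exists d => // y Zy xy; have := dP y Zy xy; rewrite -ball_normE.
Qed.

Let F_closed n : closed (F n).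
Proof.
apply/(@closed_ballP R T) => x nFx; have [Zx|nZx] := pselect (Z x); last first.
  have [e e0 eP] := (closed_ballP _).1 clZ _ nZx.
  by exists e => // y xy [Zy _]; exact: eP xy Zy.
have fx : f x < n.+1%:R^-1 by rewrite ltNge; apply/negP => h; exact: nFx.
have [|d d0 dP] := @f_near x (n.+1%:R^-1 - f x) Zx; first by rewrite subr_gt0.
exists d => // y xy [Zy fy]; have := dP y Zy xy.
rewrite ltr_norml => /andP[h _]; move: h fy; set c := n.+1%:R^-1.
by move=> h fy; lra.
Qed.

Let F_compact n : compact (F n).
Proof. by apply: (subclosed_compact _ kZ) => // x []. Qed.

Let F_le m n : (m <= n)%N -> F m `<=` F n.
Proof.
move=> mn x [Zx fx]; split => //; apply: le_trans fx.
by rewrite lef_pV2 ?posrE// ler_nat.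
Qed.

(** The closure of [S] is a subcontinuum that stays in [F n] and so misses [t]. *)
Let F_connected n S x y : connected S -> S `<=` F n -> S x -> S y -> comparable x y.
Proof.
move=> cS SF Sx Sy; apply: contrapT => nxy.
have clS : closure S `<=` F n 
  by rewrite ((@closure_id _ (F n)).1 (@F_closed n)); exact: closureS.
have sS : subcontinuum (closure S) Z.
  split; first by move=> z /clS[].
  split.
  - by exists x; exact: subset_closure.
  - by apply: (subclosed_compact _ kZ); [exact: closed_closure|move=> z /clS[]].
  - exact: connected_closure.
have /clS [_] := subcontinuum_incomparable sS (subset_closure Sx) (subset_closure Sy) nxy.
by rewrite ft leNgt invr_gt0 ltr0n.
Qed.

Let f_le x y : Z y -> br y x -> f x <= f y.
Proof.
by move=> Zy yx; have [->//|/eqP xy] := eqVneq x y; apply/ltW/f_mono.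
Qed.

(** The piece of branch between comparable points is connected and stays in [F n], since [f]
    increases along it; a clopen set cannot cut it. *)
Let clopen_saturated n D x y : clopen_in (F n) D -> D x -> F n y ->
  comparable x y -> D y.
Proof.
move=> [DF cD cFD] Dx Fy xy.
have [C [cC Cx Cy CF]] : exists C, [/\ connected C, C x, C y & C `<=` F n].
  have [Zx fx] := DF _ Dx; have [Zy fy] := Fy.
  case: xy => [xy|yx].
    have [C [cC Cy Cx CP]] := branch_interval_connected dZ Zt Zx xy.
    exists C; split => // z /CP[xz zy].
    have Zz := branch_sub dZ Zt Zx xz.
    by split => //; apply: le_trans fy _; exact: f_le.
  have [C [cC Cx Cy CP]] := branch_interval_connected dZ Zt Zy yx.
  exists C; split => // z /CP[yz zx].
  have Zz := branch_sub dZ Zt Zy yz.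
  by split => //; apply: le_trans fx _; exact: f_le.
suff CD : C `&` D = C by move: Cy; rewrite -CD => -[].
apply: cC; first by exists x.
- exists (~` (F n `\` D)); first exact: closed_openC.
  apply/seteqP; split => [z [Cz Dz]|z [Cz nDz]]; split => //; first by case.
  by apply: contrapT => nD; apply: nDz; split => //; exact: CF.
- by exists D.
Qed.

Let extend n D := xget set0
  [set D' | [/\ clopen_in (F n.+1) D', D `<=` D' & D' `&` (F n `\` D) = set0]].

(** A connected subset of [F n.+1] from [D] to the rest of [F n] would have comparable ends, against
    saturation of [D]; so [cut_wire] applies. *)
Let extendP n D : clopen_in (F n) D ->
  [/\ clopen_in (F n.+1) (extend n D), D `<=` extend n D
    & extend n D `&` (F n `\` D) = set0].
Proof.
move=> cD; rewrite /extend; case: xgetP => // nD; exfalso.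
have [DF clD clFD] := cD.
have [||||S a b cS SF Sa Sb Da [Fb nDb]|D' D'P] :=
  @cut_wire _ _ _ D (F n `\` D) (@F_compact n.+1).
- exact: clD.
- exact: clFD.
- by apply: (subset_trans DF); exact: F_le.
- by move=> x [Fx _]; exact: F_le Fx.
- by apply: nDb; apply: clopen_saturated cD Da Fb _; exact: F_connected cS SF Sa Sb.
- exact: nD D' D'P.
Qed.

Let clopen_chain n D := fix chain (k : nat) : set T :=
  if k is k'.+1 then extend (n + k') (chain k') else D.

(** That is, [W] is relatively clopen in Z minus [t]. *)
Let locally_decided (W : set T) := forall z, Z z -> z <> t ->
  exists2 e : R, 0 < e & forall y, Z y -> ball z e y -> (W y <-> W z).

Let f_gt0 x : Z x -> x <> t -> 0 < f x.
Proof.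
move=> Zx xt; rewrite -ft; apply: f_mono => //; last exact/nesym.
exact: (branch_top_mem dZ Zt).
Qed.

Let F_exhaust r : 0 < r -> exists n : nat, n.+1%:R^-1 < r :> R.
Proof.
move=> r0; have [n _ nr] := near_infty_natSinv_lt (PosNum r0).
by exists n; apply: (nr n) => /=.
Qed.

(** Later stages never change earlier ones, so the union meets [F (n + k)] in the k-th stage. A
    point other than [t] has a neighbourhood inside some [F (n + k)], where that stage is clopen. *)
Let chain_locally_decided n D : clopen_in (F n) D ->
  locally_decided (\bigcup_k clopen_chain n D k) /\
  (\bigcup_k clopen_chain n D k) `&` F n = D.
Proof.
move=> cD; set E := clopen_chain n D; set W := \bigcup_k _.
have cE k : clopen_in (F (n + k)) (E k).
  elim: k => [|k IH]; first by rewrite addn0.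
  by rewrite addnS; have [] := extendP IH.
have ES k : E k `<=` E k.+1 by have [] := extendP (cE k).
have EI k : E k.+1 `&` F (n + k) `<=` E k.
  move=> x [E1 Fx]; apply: contrapT => nE; have [_ _ I0] := extendP (cE k).
  by rewrite -[False]/(set0 x) -I0.
have WE k : W `&` F (n + k) = E k.
  apply/seteqP; split; last by move=> x Ex; split; [exists k|case: (cE k) => + _ _; exact].
  move=> x [[j _ Ej] Fx]; have [jk|/ltnW kj] := leqP j k.
    move: Ej; rewrite -(subnK jk); elim: (k - j)%N => // i IH /IH; exact: ES.
  move: Ej; rewrite -(subnK kj); elim: (j - k)%N => // i IH Ei; apply: IH.
  apply: EI; split; first by move: Ei; rewrite addSn.
  by apply: F_le Fx; rewrite leq_add2l leq_addl.
split; last by have := WE 0%N; rewrite addn0.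
move=> z Zz zt; have fz := f_gt0 Zz zt.
have [k kz] := F_exhaust fz.
have kn : (n + k).+1%:R^-1 < f z.
  apply: le_lt_trans kz; rewrite lef_pV2 ?posrE// ler_nat ltnS; exact: leq_addl.
have [|d d0 dP] := @f_near z (f z - (n + k).+1%:R^-1) Zz; first by rewrite subr_gt0.
have Fz : F (n + k) z by split => //; exact: ltW.
have dF y : Z y -> ball z d y -> F (n + k) y.
  move=> Zy zy; split => //; have := dP y Zy zy.
  rewrite ltr_norml => /andP[_]; set c := _.+1%:R^-1 => h; lra.
have WEy y : F (n + k) y -> W y <-> E k y by move=> Fy; rewrite -WE; split => // -[].
have [EF clE clFE] := cE k.
have dec (P : set T) : closed P -> ~ P z ->
    exists2 e : R, 0 < e & forall y, Z y -> ball z e y -> F (n + k) y /\ ~ P y.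
  move=> clP nPz; have [e e0 eP] := (closed_ballP _).1 clP _ nPz.
  exists (Num.min d e); first by rewrite lt_min d0.
  move=> y Zy zy; split.
    by apply: dF => //; apply: le_ball zy; rewrite ge_min lexx.
  by apply: eP; apply: le_ball zy; rewrite ge_min lexx orbT.
have [Ez|nEz] := pselect (E k z).
  have [|e e0 eP] := dec _ clFE; first by case.
  exists e => // y Zy zy; have [Fy nFE] := eP y Zy zy.
  split => _; [exact/WEy|apply/WEy => //].
  by apply: contrapT => nE; exact: nFE.
have [e e0 eP] := dec _ clE nEz.
exists e => // y Zy zy; have [Fy nE] := eP y Zy zy.
by split => [/(WEy _ Fy)|/(WEy _ Fz)].
Qed.

Let incomparable_separation x y : Z x -> Z y -> x <> t -> y <> t ->
  ~ comparable x y -> exists W, [/\ locally_decided W, W x & ~ W y].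
Proof.
move=> Zx Zy xt yt nxy.
have [|n nr] := @F_exhaust (Num.min (f x) (f y)).
  by rewrite lt_min !f_gt0.
have [Fx Fy] : F n x /\ F n y.
  by split; split => //; apply: le_trans (ltW nr) _; rewrite ge_min lexx ?orbT.
have [||||S a b cS SF Sa Sb ax bx|D [cD xD Dy]] :=
  @cut_wire _ _ (F n) [set x] [set y] (@F_compact n).
- by apply: compact_closed; [exact: metric_hausdorff|exact: compact_set1].
- by apply: compact_closed; [exact: metric_hausdorff|exact: compact_set1].
- by move=> _ ->.
- by move=> _ ->.
- by apply: nxy; rewrite -ax -bx; exact: F_connected cS SF Sa Sb.
have [ld WD] := chain_locally_decided cD.
set W := \bigcup_k _ in ld WD; exists W; split => //.
  suff [] : (W `&` F n) x by [].
  by rewrite WD; exact: xD.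
move=> Wy; suff : (D `&` [set y]) y by rewrite Dy.
by split => //; rewrite -WD.
Qed.

Lemma smooth_fan_itinerary : exists k : T -> nat -> bool,
  (forall n x, Z x -> x <> t -> exists2 e : R, 0 < e &
     forall y, Z y -> ball x e y -> k y n = k x n) /\
  (forall x y, Z x -> Z y -> x <> t -> y <> t -> f x = f y -> k x = k y -> x = y).
Proof.
have [p [Zp pd]] := compact_dense_sequence (ex_intro _ t Zt) kZ.
(* Countability: one separating set is kept for each pair of centres in the dense sequence and each
   radius, if there is one that contains the first ball and misses the second. *)
pose P (q : nat * nat * nat) (W : set T) := [/\ locally_decided W,
  forall z, Z z -> ball (p q.1.1) q.2.+1%:R^-1 z -> W z &
  forall z, Z z -> ball (p q.1.2) q.2.+1%:R^-1 z -> ~ W z].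
(* Without a separating set the choice is the empty set, which is locally decided too. *)
pose W n := xget set0 (P (odflt (0%N, 0%N, 0%N) (unpickle n))).
have ldW n : locally_decided (W n).
  rewrite /W; case: xgetP => [V _ []//|_ z _ _].
  by exists 1.
exists (fun x n => `[< W n x >]); split.
  move=> n x Zx xt; have [e e0 eP] := ldW n x Zx xt.
  exists e => // y Zy xy; have [h1 h2] := eP y Zy xy.
  by apply/asboolP/asboolP.
move=> x y Zx Zy xt yt fxy kxy.
have [xy|nxy] := pselect (comparable x y).
  apply: contrapT => nxy; case: xy => [xy|yx].
    by have := f_mono Zx xy (nesym nxy); rewrite fxy ltxx.
  by have := f_mono Zy yx nxy; rewrite fxy ltxx.
exfalso; have [V [ldV Vx nVy]] := incomparable_separation Zx Zy xt yt nxy.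
have [e e0 eP] := ldV _ Zx xt; have [d d0 dP] := ldV _ Zy yt.
have [|m mr] := @F_exhaust (Num.min e d / 2); first by rewrite divr_gt0// lt_min e0.
have m0 : 0 < m.+1%:R^-1 :> R by [].
have [i ix] := pd _ _ Zx m0; have [j jy] := pd _ _ Zy m0.
have PV : P (i, j, m) V.
  split => //= z Zz; rewrite ballEmdist /= => iz.
    apply/(eP z Zz) => //; rewrite ballEmdist /=.
    have := metric_triangle x (p i) z; rewrite (metric_sym x (p i)).
    have : Num.min e d <= e by rewrite ge_min lexx.
    by move: mr ix iz; move: (m.+1%:R^-1 : R) => c; lra.
  move=> Vz; apply: nVy; apply/(dP z Zz) => //; rewrite ballEmdist /=.
  have := metric_triangle y (p j) z; rewrite (metric_sym y (p j)).
  have : Num.min e d <= d by rewrite ge_min lexx orbT.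
  by move: mr jy iz; move: (m.+1%:R^-1 : R) => c; lra.
have [_ Wi Wj] : P (i, j, m) (W (pickle (i, j, m))).
  by rewrite /W pickleK /=; exact: (xgetI _ PV).
have := congr1 (fun k => k (pickle (i, j, m))) kxy => /=.
have -> : `[< W (pickle (i, j, m)) x >] = true.
  by apply/asboolP; apply: Wi => //; rewrite ballEmdist.
have -> : `[< W (pickle (i, j, m)) y >] = false.
  by apply/asboolPn; apply: Wj => //; rewrite ballEmdist.
by [].
Qed.

End SmoothFanCoordinates.

(** * Subcontinua of the planar Cantor fan *)

Section MiddleThirds.
Context {R : realType}.

Lemma middle_thirds_stage_sub n (x : R) : middle_thirds_stage n x -> 0 <= x <= 1.
Proof.
elim: n x => [x|n IH x]; first by rewrite /= in_itv.
by move=> /= [] [y /IH/andP[y0 y1] <-]; apply/andP; split; lra.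
Qed.

(** An interval in a stage lies in one of the outer thirds; tripling moves it to the previous
    stage. *)
Lemma middle_thirds_stage_interval n (a b : R) : a <= b ->
  (forall x, a <= x <= b -> middle_thirds_stage n x) -> b - a <= 3^-1 ^+ n.
Proof.
elim: n a b => [|n IH] a b ab h.
  have /= := h a; have /= := h b; rewrite !in_itv /= !lexx ab expr0.
  by move=> /(_ isT)/andP[? ?] /(_ isT)/andP[? ?]; lra.
have hz x : a <= x <= b ->
    middle_thirds_stage n (3 * x) /\ x <= 3^-1 \/
    middle_thirds_stage n (3 * x - 2) /\ 2 / 3 <= x.
  move=> /h /= [] [y ny <-]; have /andP[y0 y1] := middle_thirds_stage_sub ny;
    [left|right]; split; try lra.
  - by rewrite (_ : 3 * (y / 3) = y)//; field.
  - by rewrite (_ : 3 * (2 / 3 + y / 3) - 2 = y)//; field.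
have [b13|b13] := leP b 3^-1.
  have := IH (3 * a) (3 * b); rewrite exprS => h3.
  suff : 3 * b - 3 * a <= 3^-1 ^+ n by move: (_ ^+ n) => e; lra.
  apply: h3; first lra.
  move=> x /andP[ax xb]; have [|[]|[]] := hz (x / 3).
  - by apply/andP; split; lra.
  - by rewrite (_ : 3 * (x / 3) = x)//; field.
  - by move=> _; lra.
have [a13|a13] := leP a 3^-1.
  (* Here a <= 1/3 < b, and this point of the interval falls into the removed middle third. *)
  have [|[_]|[_]] := hz (Num.min b 2^-1).
  - by rewrite le_min ab ge_min lexx /=; lra.
  - by rewrite leNgt lt_min b13 /=; lra.
  - by rewrite le_min => /andP[_]; lra.
have := IH (3 * a - 2) (3 * b - 2); rewrite exprS => h3.
suff : (3 * b - 2) - (3 * a - 2) <= 3^-1 ^+ n by move: (_ ^+ n) => e; lra.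
apply: h3; first lra.
move=> x /andP[ax xb]; have [|[]|[]] := hz ((x + 2) / 3).
- by apply/andP; split; lra.
- by move=> _; lra.
- by rewrite (_ : 3 * ((x + 2) / 3) - 2 = x)//; field.
Qed.

(** The complement is dense: every leg can be enclosed between two rays, arbitrarily close to it,
    that carry no leg. *)
Definition codense (C : set R) := forall a b, a < b -> exists c, a < c < b /\ ~ C c.

Lemma middle_third_cantor_codense : codense (@middle_third_cantor R).
Proof.
move=> a b ab; apply: contrapT => h.
have sub x : a < x < b -> middle_third_cantor x.
  by move=> xab; apply: contrapT => nx; apply: h; exists x.
have d0 : 0 < (b - a) / 3 by rewrite divr_gt0// subr_gt0.
have [n _ /(_ n (leqnn n)) /= nd] := near_infty_natSinv_expn_lt (PosNum d0).
have : (2 * b + a) / 3 - (b + 2 * a) / 3 <= 3^-1 ^+ n.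
  apply: middle_thirds_stage_interval; first lra.
  by move=> x /andP[xa xb]; apply: sub => //; apply/andP; split; lra.
have : 3^-1 ^+ n <= 1 / 2 ^+ n :> R.
  by rewrite div1r -exprVn lerXn2r ?nnegrE ?invr_ge0// lef_pV2 ?posrE// ler_nat.
move: (3^-1 ^+ n) (1 / 2 ^+ n) nd => e e'; lra.
Qed.

(** An interval inside [C] would be carried onto a nondegenerate interval of the middle-third
    set. *)
Lemma cantor_set_codense (C : set R) : cantor_set C -> codense C.
Proof.
move=> [f hf] a b ab; apply: contrapT => h.
pose a' := (b + 2 * a) / 3; pose b' := (2 * b + a) / 3.
have ab' : a' <= b' by rewrite /a' /b'; lra.
have sub : `[a', b'] `<=` C.
  move=> x; rewrite /= in_itv /= => /andP[xa xb]; apply: contrapT => nx.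
  by apply: h; exists x; split => //; move: xa xb; rewrite /a' /b' => *; apply/andP; split; lra.
have hsub := homeomorphism_sub hf sub.
have iA : is_interval (f @` `[a', b']).
  apply/connected_intervalP; apply: homeomorphism_connected hsub _.
  exact: segment_connected.
have fa : (f @` `[a', b']) (f a') by apply: imageP; rewrite /= in_itv /= lexx.
have fb : (f @` `[a', b']) (f b') by apply: imageP; rewrite /= in_itv /= lexx andbT.
have fab : f a' != f b'.
  apply/eqP => /(homeomorphism_inj hf) eab.
  have : a' = b' by apply: eab; apply: sub; rewrite /= in_itv /= lexx ?andbT.
  by rewrite /a' /b'; lra.
have iM x y z : (f @` `[a', b']) x -> (f @` `[a', b']) y -> x < z < y ->
    middle_third_cantor z.
  move=> fx fy /andP[xz zy].
  have [w wab <-] : (f @` `[a', b']) z by apply: (iA x y) => //; rewrite !ltW.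
  by rewrite -(homeomorphism_image hf); apply: imageP; exact: sub.
case/lt_total/orP: fab => fab;
  by have [c [cab]] := middle_third_cantor_codense fab; apply; exact: iM cab.
Qed.

End MiddleThirds.

(** * Closed connected subsets of the planar fan *)

Section PlanarFan.
Context {R : realType}.
Implicit Types (s c : R) (S : set (R * R)).
Local Notation I01 := (`[0, 1]%classic : set R).

(* The point of height s on the leg from (0, 0) to (c, -1). *)
Definition leg_point s c : R * R := (s * c, - s).

Definition planar_fan (C : set R) : set (R * R) :=
  [set p | exists c s, [/\ C c, 0 <= s <= 1 & p = leg_point s c]].

Lemma planar_fanE (C : set R) :
  \bigcup_(c in C) plane_segment (0, 0) (c, -1) = planar_fan C.
Proof.
have E s c : ((1 - s) * 0 + s * c, (1 - s) * 0 + s * -1) = leg_point s c.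
  by rewrite /leg_point !mulr0 !add0r mulrN1.
apply/seteqP; split => [_ [c Cc [s s01 <-]]|_ [c [s [Cc s01 ->]]]].
  by exists c, s; rewrite E; split => //; move: s01; rewrite /= in_itv.
by exists c => //; exists s; rewrite ?E//= in_itv.
Qed.

Lemma leg_point0 c : leg_point 0 c = 0.
Proof. by rewrite /leg_point mul0r oppr0. Qed.

Lemma leg_point_inj s c s' c' : leg_point s c = leg_point s' c' ->
  s = s' /\ (s <> 0 -> c = c').
Proof.
move=> [e /oppr_inj es]; rewrite -es in e *; split => // /eqP s0.
exact: mulfI e.
Qed.

Lemma affine_continuous (a b d : R) :
  continuous (fun z : R * R => a * z.1 + b * z.2 + d).
Proof.
move=> z; apply: cvgD; last exact: cvg_cst.
by apply: cvgD; apply: cvgM; [exact: cvg_cst|exact: cvg_fst|exact: cvg_cst|exact: cvg_snd].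
Qed.

Lemma pair_continuous (S : topologicalType) (f g : S -> R) :
  continuous f -> continuous g -> continuous (fun x => (f x, g x)).
Proof. by move=> cf cg x; exact: (cvg_pair (cf x) (cg x)). Qed.

Lemma affine_open (a b d : R) : open [set z : R * R | 0 < a * z.1 + b * z.2 + d].
Proof.
have /continuousP h := @affine_continuous a b d.
by have := h [set x | 0 < x] (@open_gt R 0).
Qed.

Lemma affine_closed (a b d : R) : closed [set z : R * R | 0 <= a * z.1 + b * z.2 + d].
Proof.
have /continuous_closedP h := @affine_continuous a b d.
by have := h [set x | 0 <= x] (@closed_ge R 0).
Qed.

Context {C : set R}.
Hypotheses (C01 : C `<=` `[0, 1]) (codC : codense C).

(* If a point below p on its leg is missing from S, the leg above the missing
   point is cut off from the rest of S by a narrow wedge whose two sides have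
   slopes outside C. *)
Lemma planar_connected_leg S p_s c q s : closed S -> connected S ->
  S `<=` planar_fan C -> S (leg_point p_s c) -> S q -> 0 < s < p_s ->
  S (leg_point s c) \/ exists2 s', q = leg_point s' c & s < s'.
Proof.
move=> clS cS SC Sp Sq /andP[s0 sp].
have [Ss|nSs] := pselect (S (leg_point s c)); [by left|right].
have [e e0 eS] := (closed_ballP _).1 clS _ nSs.
have [g [r [Cg r01 qE]]] := SC _ Sq.
apply: contrapT => nq.
(* The bound [e / s] puts points of height [s] and slope within [d] of [c] into the ball that [S]
   misses; if [q] is on another leg, [d] also excludes its slope. *)
have [d d0 dP] : exists2 d, 0 < d <= e / s & c - d < g < c + d -> r <= s.
  have es0 : 0 < e / s by rewrite divr_gt0.
  have [gc|gc] := eqVneq g c.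
    exists (e / s); first by rewrite es0 lexx.
    move=> _; rewrite leNgt; apply/negP => sr; apply: nq; exists r => //.
    by rewrite qE gc.
  exists (Num.min (e / s) `|g - c|).
    by rewrite lt_min es0 normr_gt0 subr_eq0 gc ge_min lexx.
  by rewrite -ltr_distl lt_min ltxx andbF.
case/andP: d0 => d0 des.
have [c1 [/andP[dc1 c1c] nC1]] : exists c1, c - d < c1 < c /\ ~ C c1.
  by apply: codC; rewrite ltrBlDr ltrDl.
have [c2 [/andP[cc2 c2d] nC2]] : exists c2, c < c2 < c + d /\ ~ C c2.
  by apply: codC; rewrite ltrDl.
(* The open wedge and the closed wedge [W'] have the same trace on [S]: their sides carry no leg,
   and the base near [c] lies in the missed ball. So the trace is relatively clopen. *)
pose W := [set z : R * R | 0 < 0 * z.1 + (-1) * z.2 + (- s)] `&`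
  ([set z : R * R | 0 < 1 * z.1 + c1 * z.2 + 0] `&`
   [set z : R * R | 0 < (-1) * z.1 + (- c2) * z.2 + 0]).
pose W' := [set z : R * R | 0 <= 0 * z.1 + (-1) * z.2 + (- s)] `&`
  ([set z : R * R | 0 <= 1 * z.1 + c1 * z.2 + 0] `&`
   [set z : R * R | 0 <= (-1) * z.1 + (- c2) * z.2 + 0]).
have WP r' g' : 0 < r' -> W (leg_point r' g') <-> [/\ s < r', c1 < g' & g' < c2].
  move=> r0; rewrite /W /leg_point /=; split.
    by move=> [h1 [h2 h3]]; split; [lra|nra|nra].
  by move=> [h1 h2 h3]; split; [lra|split; nra].
have W'P r' g' : 0 < r' -> W' (leg_point r' g') -> [/\ s <= r', c1 <= g' & g' <= c2].
  move=> r0; rewrite /W' /leg_point /=.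
  by move=> [h1 [h2 h3]]; split; [lra|nra|nra].
have SW : S `&` W = S `&` W'.
  apply/seteqP; split => [z [Sz [w1 [w2 w3]]]|z [Sz W'z]].
    by split => //; split; [exact: ltW|split; exact: ltW].
  split => //; have [g' [r' [Cg' /andP[r0 r1] zE]]] := SC _ Sz.
  have r'0 : 0 < r'.
    case: W'z; rewrite zE /= => + _; lra.
  rewrite zE in W'z Sz *; have [sr cg gc] := W'P _ _ r'0 W'z.
  have cg' : c1 < g' by rewrite lt_neqAle cg andbT; apply/eqP => h; apply: nC1; rewrite h.
  have gc' : g' < c2 by rewrite lt_neqAle gc andbT; apply/eqP => h; apply: nC2; rewrite -h.
  apply/WP => //; split => //; rewrite lt_neqAle sr andbT; apply/eqP => rs.
  apply: (eS _ _ Sz); split => /=; rewrite -ball_normE /ball_ /= -rs ?subrr ?normr0//.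
  rewrite -mulrBr normrM gtr0_norm// mulrC -ltr_pdivlMr// (lt_le_trans _ des)//.
  by rewrite ltr_norml; apply/andP; split; lra.
have SWS : S `&` W = S.
  apply: cS.
  - exists (leg_point p_s c); split => //; apply/WP; last by split.
    exact: lt_trans sp.
  - exists W => //; rewrite /W; apply: openI; first exact: affine_open.
    by apply: openI; exact: affine_open.
  - exists W' => //; rewrite /W'; apply: closedI; first exact: affine_closed.
    by apply: closedI; exact: affine_closed.
have [_ Wq] : (S `&` W) q by rewrite SWS.
have r0 : 0 < r by case: Wq; rewrite qE /= => + _; lra.
move: Wq; rewrite qE => /(WP _ _ r0)[sr cg gc].
by have := dP; rewrite leNgt sr => /(_ _)/negP; apply => //; apply/andP; split; lra.
Qed.

Lemma planar_connected_origin S c s : closed S -> C c -> 0 < s ->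
  (forall s', 0 < s' < s -> S (leg_point s' c)) -> S 0.
Proof.
move=> clS Cc s0 h; apply: contrapT => nS0.
have [e e0 eS] := (closed_ballP _).1 clS _ nS0.
have m0 : 0 < Num.min s e / 2 by rewrite divr_gt0// lt_min s0.
have ms : Num.min s e / 2 < s.
  have : Num.min s e <= s by rewrite ge_min lexx.
  by move: s0; lra.
have me : Num.min s e / 2 < e.
  have : Num.min s e <= e by rewrite ge_min lexx orbT.
  by move: e0; lra.
move: (Num.min s e / 2) m0 ms me => m m0 ms me.
apply: (eS (leg_point m c)); last by apply: h; rewrite m0.
have /andP[c0 c1] : 0 <= c <= 1 by have := C01 Cc; rewrite /= in_itv.
have mc : m * c <= m by nra.
split; rewrite -ball_normE /ball_ /= sub0r normrN.
  by rewrite ger0_norm ?mulr_ge0 ?(ltW m0)//; exact: le_lt_trans me.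
by rewrite normrN gtr0_norm.
Qed.

(** The last clause says that the path is forced; arcs and unicoherence both come from it. *)
Lemma planar_path p q : planar_fan C p -> planar_fan C q -> p <> q ->
  exists g : R -> R * R,
  [/\ continuous g, (forall x y, I01 x -> I01 y -> g x = g y -> x = y),
      g 0 = p, g 1 = q
    & forall S, closed S -> connected S -> S `<=` planar_fan C -> S p -> S q ->
        g @` I01 `<=` S].
Proof.
have straight s s' c : C c -> 0 <= s -> 0 <= s' -> s <> s' ->
    exists g : R -> R * R,
    [/\ continuous g, (forall x y, I01 x -> I01 y -> g x = g y -> x = y),
      g 0 = leg_point s c, g 1 = leg_point s' c
    & forall S, closed S -> connected S -> S `<=` planar_fan C ->
        S (leg_point s c) -> S (leg_point s' c) -> g @` I01 `<=` S].
  move=> Cc s0 s'0 ss'.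
  exists (fun x => leg_point (s + x * (s' - s)) c); split.
  - apply: pair_continuous => x.
      by apply: cvgM; [exact: continuous_affine|exact: cvg_cst].
    by apply: cvgN; exact: continuous_affine.
  - move=> x y _ _ /leg_point_inj[/addrI /mulIf + _]; apply.
    by rewrite subr_eq0 eq_sym; exact/eqP.
  - by rewrite mul0r addr0.
  - by rewrite mul1r addrC subrK.
  - move=> S clS cS SC Ss Ss' _ [x + <-]; rewrite /= in_itv /= => /andP[x0 x1].
    have [xs|/eqP xs] := eqVneq (s + x * (s' - s)) s; first by rewrite xs.
    have [xs'|/eqP xs'] := eqVneq (s + x * (s' - s)) s'; first by rewrite xs'.
    move: xs xs'; set r := s + _ => rs rs'.
    have [lt_ss|lt_ss|//] := ltgtP s s'.
      have [|//|[s2 /leg_point_inj[]]] := @planar_connected_leg S s' c (leg_point s c) r clS cS SC Ss' Ss.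
        have : s <= r <= s' by rewrite /r; apply/andP; split; nra.
        move=> /andP[]; rewrite le_eqVlt => /orP[/eqP/esym//|sr].
        by rewrite le_eqVlt => /orP[/eqP//|->]; rewrite (le_lt_trans s0).
      by move=> <- _; rewrite ltNge; move=> /negP[]; rewrite /r; nra.
    have [|//|[s2 /leg_point_inj[]]] := @planar_connected_leg S s c (leg_point s' c) r clS cS SC Ss Ss'.
      have : s' <= r <= s by rewrite /r; apply/andP; split; nra.
      move=> /andP[]; rewrite le_eqVlt => /orP[/eqP/esym//|sr].
      by rewrite le_eqVlt => /orP[/eqP//|->]; rewrite (le_lt_trans s'0).
    by move=> <- _; rewrite ltNge; move=> /negP[]; rewrite /r; nra.
move=> [c [s [Cc /andP[s0 s1] ->]]] [c' [s' [Cc' /andP[s'0 s'1] ->]]] pq.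
(* The origin lies on every leg, so it may be given the slope of the other point. *)
have [sz|sn0] := eqVneq s 0.
  rewrite sz leg_point0 -(leg_point0 c'); apply: straight => //.
  by move=> s'z; apply: pq; rewrite sz -s'z !leg_point0.
have [s'z|s'n0] := eqVneq s' 0.
  rewrite s'z leg_point0 -(leg_point0 c); apply: straight => //.
  exact/eqP.
have [cc'|cc'] := eqVneq c c'.
  by rewrite -cc'; apply: straight => // ss'; apply: pq; rewrite ss' cc'.
have {}s0 : 0 < s by rewrite lt_neqAle eq_sym sn0.
have {}s'0 : 0 < s' by rewrite lt_neqAle eq_sym s'n0.
(* Signed height: negative on the first leg, positive on the second. The negative and positive parts
   of [w] select the slope, so [g] is given by one continuous formula. *)
pose w x := - s + x * (s' + s).
have ss0 : 0 < s' + s by rewrite addr_gt0.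
pose g x := ((`|w x| - w x) / 2 * c + (`|w x| + w x) / 2 * c', - `|w x|).
have gn x : w x <= 0 -> g x = leg_point (- w x) c.
  by move=> w0; rewrite /g /leg_point ler0_norm//; congr pair; field.
have gp x : 0 <= w x -> g x = leg_point (w x) c'.
  by move=> w0; rewrite /g /leg_point ger0_norm//; congr pair; field.
have w_inj x y : w x = w y -> x = y.
  by move=> /addrI /mulIf; apply; rewrite gt_eqF.
exists g; split.
- have cw : continuous w.
    move=> x; apply: cvgD; first exact: cvg_cst.
    by apply: cvgM; [exact: cvg_id|exact: cvg_cst].
  have cn : continuous (fun x => `|w x|) by move=> x; apply: cvg_norm; exact: cw.
  apply: pair_continuous => x; last by apply: cvgN; exact: cn.
  apply: cvgD; (apply: cvgM; last exact: cvg_cst);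
    (apply: cvgM; last exact: cvg_cst).
    by apply: cvgB; [exact: cn|exact: cw].
  by apply: cvgD; [exact: cn|exact: cw].
- move=> x y _ _.
  have [x0|x0] := leP (w x) 0; have [y0|y0] := leP (w y) 0.
  + by rewrite !gn// => /leg_point_inj[/oppr_inj /w_inj].
  + rewrite gn// gp ?(ltW y0)// => /leg_point_inj[xy] h; exfalso.
    by move/eqP: cc'; apply; apply: h; rewrite xy; apply/eqP; rewrite gt_eqF.
  + rewrite gp ?(ltW x0)// gn// => /leg_point_inj[xy] h; exfalso.
    by move/eqP: cc'; apply; apply/esym/h; apply/eqP; rewrite gt_eqF.
  + by rewrite !gp ?(ltW x0) ?(ltW y0)// => /leg_point_inj[/w_inj].
- by rewrite gn /w mul0r addr0 ?opprK// oppr_le0 ltW.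
- by rewrite gp /w mul1r addrC addrK// ltW.
- move=> S clS cS SC Sp Sq _ [x + <-]; rewrite /= in_itv /= => /andP[x0 x1].
  (* The other end lies on a different leg, which rules out the second alternative of
     [planar_connected_leg]. *)
  have down r : 0 < r <= s -> S (leg_point r c).
    move=> /andP[r0]; rewrite le_eqVlt => /orP[/eqP ->//|rs].
    have [|//|[s2 /leg_point_inj[_ e] _]] :=
      @planar_connected_leg S s c _ r clS cS SC Sp Sq; first by rewrite r0.
    by move/eqP: cc'; case; rewrite e//; exact/eqP.
  have down' r : 0 < r <= s' -> S (leg_point r c').
    move=> /andP[r0]; rewrite le_eqVlt => /orP[/eqP ->//|rs].
    have [|//|[s2 /leg_point_inj[_ e] _]] :=
      @planar_connected_leg S s' c' _ r clS cS SC Sq Sp; first by rewrite r0.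
    by move/eqP: cc'; case; rewrite e//; exact/eqP.
  have [wx|wx|wx] := ltgtP (w x) 0.
  + rewrite gn ?ltW//; apply: down; rewrite oppr_gt0 wx /= /w.
    by rewrite opprD opprK gerDl oppr_le0 mulr_ge0// ltW.
  + rewrite gp ?ltW//; apply: down'; rewrite wx /= /w.
    by move: x1; nra.
  + rewrite gn ?wx// oppr0 leg_point0; apply: (planar_connected_origin clS Cc s0).
    by move=> s2 /andP[s20 /ltW s2s]; apply: down; rewrite s20.
Qed.

End PlanarFan.

(** * Planar fans are smooth fans *)

(** Pairs violating the bound for smaller and smaller [d] would accumulate at a point of [A],
    against continuity there. *)
Lemma compact_uniform_continuity (R : realType) (S T : pseudoMetricType R)
    (A : set S) (g : S -> T) (e : R) :
  compact A -> {within A, continuous g} -> 0 < e ->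
  exists2 d, 0 < d & forall x y, A x -> A y -> ball x d y -> ball (g x) e (g y).
Proof.
move=> cA cg e0; apply: contrapT => nd.
pose D (d : R) := [set x | A x /\ exists2 y, A y & ball x d y /\ ~ ball (g x) e (g y)].
have [|||_ _ [d1 d10 ->] [d2 d20 ->]|_ [d d0 ->]|p [Ap _ pE]] :=
  @compact_directed_meet _ A setT [set X | exists2 d, 0 < d & X = closure (D d)] cA.
- exact: closedT.
- by exists (closure (D 1)); exists 1.
- by move=> _ [d _ ->]; exact: closed_closure.
- exists (closure (D (Num.min d1 d2))).
    by exists (Num.min d1 d2) => //; rewrite lt_min d10.
  rewrite subsetI; split; apply: closureS => x [Ax [y Ay [xy nxy]]]; split => //;
    exists y => //; split => //; apply: le_ball xy; by rewrite ge_min lexx ?orbT.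
- apply: contrapT => nD; apply: nd; exists d => // x y Ax Ay xy.
  apply: contrapT => nxy; apply: nD; exists x; split => //; split => //.
  by apply: subset_closure; split => //; exists y.
have e20 : 0 < e / 2 by rewrite divr_gt0.
have [d d0 dP] := (within_ballP _ _).1 cg p Ap _ e20.
have d20 : 0 < d / 2 by rewrite divr_gt0.
have : closure (D (d / 2)) p by apply: pE; exists (d / 2).
move=> /(_ _ (nbhsx_ballx p (d / 2) d20)) [x [[Ax [y Ay [xy nxy]]] px]].
apply: nxy; rewrite (splitr e); apply: (@ball_triangle _ _ (g p)).
  by apply: ball_sym; apply: dP => //; apply: le_ball px; rewrite ler_pdivrMr// ler_peMr ?ler1n ?ltW.
by apply: dP => //; rewrite (splitr d); exact: ball_triangle px xy.
Qed.

Section PlanarModel.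
Context {R : realType} {T : metricType R} {C : set R}.
Variables (L : set T) (F : T -> R * R).
Hypotheses (C01 : C `<=` `[0, 1]) (codC : codense C).
Hypotheses (cL : continuum L) (hF : homeomorphism L (F @` L) F)
  (FC : F @` L `<=` planar_fan C).
Local Notation I01 := (`[0, 1]%classic : set R).

Let cF : {within L, continuous F}. Proof. exact: homeomorphism_continuous hF. Qed.

Let F_inj x y : L x -> L y -> F x = F y -> x = y.
Proof. exact: (homeomorphism_inj hF). Qed.

Lemma planar_image K : subcontinuum K L ->
  [/\ closed (F @` K), connected (F @` K) & F @` K `<=` planar_fan C].
Proof.
move=> [KL [_ kK cK]].
have cFK : {within K, continuous F} by exact: continuous_subspaceW cF.
split.
- by apply: compact_closed; [exact: norm_hausdorff|exact: continuous_compact].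
- exact: connected_continuous_connected.
- by move=> _ [x /KL Lx <-]; apply: FC; exact: imageP.
Qed.

Lemma planar_model_arc x y : L x -> L y -> x <> y -> exists A,
  [/\ A `<=` L, arc_between A x y &
      forall K, subcontinuum K L -> K x -> K y -> A `<=` K].
Proof.
move=> Lx Ly xy; have [G [hG GF FG]] := homeomorphism_inv hF.
have FP z : L z -> planar_fan C (F z) by move=> Lz; apply: FC; exact: imageP.
have nFxy : F x <> F y by move/(F_inj Lx Ly).
have [g [cg ginj g0 g1 gS]] := planar_path C01 codC (FP _ Lx) (FP _ Ly) nFxy.
have sub K : subcontinuum K L -> K x -> K y -> g @` I01 `<=` F @` K.
  move=> KL Kx Ky; have [clK cK KC] := planar_image KL.
  by apply: gS => //; exact: imageP.
have gL z : I01 z -> (F @` L) (g z).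
  by move=> z01; apply: (sub L _ Lx Ly _ (imageP g z01)); split.
have hGg : homeomorphism I01 ((G \o g) @` I01) (G \o g).
  apply: compact_injective_homeomorphism.
  - exact: metric_hausdorff.
  - by exists 0; exact: zero_I01.
  - exact: segment_compact.
  - apply: (@within_comp _ _ _ _ (F @` L)) => //; first exact: continuous_subspaceT.
    exact: homeomorphism_continuous hG.
  - move=> z w z01 w01 /= /(homeomorphism_inj hG (gL _ z01) (gL _ w01)).
    exact: ginj.
have AK K : subcontinuum K L -> K x -> K y -> (G \o g) @` I01 `<=` K.
  move=> KL Kx Ky _ [z z01 <-] /=; have [k Kk <-] := sub K KL Kx Ky _ (imageP g z01).
  by rewrite GF//; exact: (proj1 KL).
exists ((G \o g) @` I01); split => //; first by apply: AK => //; split.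
by exists (G \o g); split => //=; rewrite ?g0 ?g1 GF.
Qed.

(** The arc between two common points of [A] and [B] lies in every subcontinuum through them, hence
    in both. *)
Lemma planar_model_dendroid : dendroid L.
Proof.
split => //.
- by move=> x y Lx Ly xy; have [A [AL Axy _]] := planar_model_arc Lx Ly xy; exists A.
- move=> Y [YL cY] A B cA cB ABY; apply: connected_paths => x y [Ax Bx] [Ay By].
  have AL : subcontinuum A L.
    by split => // z Az; apply: YL; rewrite -ABY; left.
  have BL : subcontinuum B L.
    by split => // z Bz; apply: YL; rewrite -ABY; right.
  have [<-|/eqP xy] := eqVneq x y.
    by exists [set x]; [exact: connected1|split => // _ ->].
  have [D [_ Dxy DK]] := planar_model_arc (proj1 AL _ Ax) (proj1 AL _ Ay) xy.
  have [[_ _ cD] Dx Dy _] := arc_betweenP Dxy.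
  by exists D => //; split => // z Dz; split; [exact: DK Dz|exact: DK Dz].
Qed.

Variable t : T.
Hypotheses (Lt : L t) (Ft : F t = 0).

Let shrink (l : R) (p : R * R) : R * R := (l * p.1, l * p.2).

Let shrink_leg l s c : shrink l (leg_point s c) = leg_point (l * s) c.
Proof. by rewrite /shrink /leg_point /= mulrA mulrN. Qed.

Lemma planar_model_leg K x l : subcontinuum K L -> K t -> K x -> I01 l ->
  (F @` K) (shrink l (F x)).
Proof.
move=> KL Kt Kx; rewrite /= in_itv /= => /andP[l0 l1].
have [clK cK KC] := planar_image KL.
have [c [s [Cc /andP[s0 s1] Fx]]] := KC _ (imageP F Kx).
rewrite Fx shrink_leg.
have [ls|ls0] := eqVneq (l * s) 0.
  by rewrite ls leg_point0 -Ft; exact: imageP.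
have lsp : 0 < l * s by rewrite lt_neqAle eq_sym ls0 mulr_ge0.
have [lss|lss] := eqVneq (l * s) s; first by rewrite lss -Fx; exact: imageP.
have [|||//|[s' e ss']] := @planar_connected_leg _ C codC (F @` K) s c 0 (l * s) clK cK KC.
- by rewrite -Fx; exact: imageP.
- by rewrite -Ft; exact: imageP.
- by rewrite lsp lt_neqAle lss /=; nra.
- move: e => /(congr1 snd) /= /esym/eqP; rewrite oppr_eq0 => /eqP s'0.
  by move: ss'; rewrite s'0 => /(lt_trans lsp); rewrite ltxx.
Qed.

Let G : R * R -> T := sval (cid (homeomorphism_inv hF)).
Let hG : homeomorphism (F @` L) L G.
Proof. by rewrite /G; case: cid => g []. Qed.
Let GF x : L x -> G (F x) = x.
Proof. by rewrite /G; case: cid => g [/= _ + _]; exact. Qed.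
Let FG p : (F @` L) p -> F (G p) = p.
Proof. by rewrite /G; case: cid => g [/= _ _]; exact. Qed.

Let LL : subcontinuum L L. Proof. by split. Qed.

(** The arc [t, x], or {t} for x = t, parametrized by homotheties of the plane, so that the arcs of
    different points can be compared at equal [l]. *)
Let radius x := [set G (shrink l (F x)) | l in I01].

Let radius_sub K x : subcontinuum K L -> K t -> K x -> radius x `<=` K.
Proof.
move=> KL Kt Kx _ [l l01 <-].
have [k Kk <-] := planar_model_leg KL Kt Kx l01.
by rewrite GF//; exact: (proj1 KL).
Qed.

Let radius_L x : L x -> radius x `<=` L.
Proof. by move=> Lx; exact: radius_sub. Qed.

Let radius_top x : L x -> radius x t.
Proof.
move=> Lx; exists 0; first exact: zero_I01.
by rewrite /shrink !mul0r -[RHS](GF Lt) Ft.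
Qed.

Let radius_end x : L x -> radius x x.
Proof.
move=> Lx; exists 1; first exact: one_I01.
by rewrite /shrink !mul1r -surjective_pairing GF.
Qed.

Let radius_continuum x : L x -> continuum (radius x).
Proof.
move=> Lx.
have cr : {within I01, continuous (fun l => G (shrink l (F x)))}.
  apply: (@within_comp _ _ _ _ (F @` L) (fun l => shrink l (F x))).
  - apply: continuous_subspaceT; apply: pair_continuous => l;
      by apply: cvgM; [exact: cvg_id|exact: cvg_cst].
  - by move=> l; exact: planar_model_leg.
  - exact: homeomorphism_continuous hG.
split.
- by exists t; exact: radius_top.
- by apply: continuous_compact => //; exact: segment_compact.
- by apply: connected_continuous_connected => //; exact: segment_connected.
Qed.

Let radius_subcontinuum x : L x -> subcontinuum (radius x) L.
Proof. by move=> Lx; split; [exact: radius_L|exact: radius_continuum]. Qed.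

Let dendroid_arc_radius x A : L x -> is_dendroid_arc L t x A -> A = radius x.
Proof.
move=> Lx [AL [[tx ->]|[tx tA]]].
  apply/esym/seteqP; split.
    by apply: radius_sub => //=; split => [_ ->//|]; split;
      [exists t|exact: compact_set1|exact: connected1].
  by move=> _ ->; exact: radius_top.
have [cA At Ax _] := arc_betweenP tA.
apply/esym; apply: (arc_between_connected_eq tA).
- by case: (radius_continuum Lx).
- by apply: radius_sub => //; split.
- exact: radius_top.
- exact: radius_end.
Qed.

Let radius_arc x : L x -> x <> t -> arc_between (radius x) t x.
Proof.
move=> Lx xt; have [A [AL tA AK]] := planar_model_arc Lt Lx (nesym xt).
have [cA At Ax _] := arc_betweenP tA.
rewrite (_ : radius x = A)//; apply/seteqP; split.
  by apply: radius_sub => //; split.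
by apply: AK; [exact: radius_subcontinuum|exact: radius_top|exact: radius_end].
Qed.

(** At equal [l] two radii are no farther apart in the plane than their ends; uniform continuity of
    [G] carries this back to L. *)
Lemma planar_model_smooth (x_ : nat -> T) (x : T) (A_ : nat -> set T) (A : set T) :
  (forall n, L (x_ n)) -> L x -> x_ @ \oo --> x ->
  (forall n, is_dendroid_arc L t (x_ n) (A_ n)) ->
  is_dendroid_arc L t x A ->
  (fun n => hausdorff_dist (A_ n) A) @ \oo --> (0 : R).
Proof.
move=> Lx_ Lx xx hA_ hA; apply/cvgrPdist_lt => e e0.
have e20 : 0 < e / 2 by rewrite divr_gt0.
have cFL : compact (F @` L) by apply: continuous_compact cF _; case: cL.
have [d d0 dP] := compact_uniform_continuity cFL (homeomorphism_continuous hG) e20.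
have [r r0 rP] := (within_ballP _ _).1 cF x Lx d d0.
move/cvg_ballP: xx => /(_ r r0); apply: filterS => n /= xn.
have {}rP := rP _ (Lx_ n) xn.
have close l : I01 l -> mdist (G (shrink l (F x))) (G (shrink l (F (x_ n)))) < e / 2.
  move=> l01.
  suff : ball (G (shrink l (F x))) (e / 2) (G (shrink l (F (x_ n)))) by rewrite ballEmdist.
  apply: dP; try exact: planar_model_leg.
  move: l01; rewrite /= in_itv /= => /andP[l0 l1].
  case: rP => b1 b2; split; [move: b1|move: b2]; rewrite -!ball_normE /ball_ /= -mulrBr normrM ger0_norm//;
    by move=> h; apply: le_lt_trans h; rewrite ler_piMl.
have mem : [set r | [/\ 0 < r, A_ n `<=` metric_neighborhood r A
                 & A `<=` metric_neighborhood r (A_ n)]] (e / 2).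
  rewrite (dendroid_arc_radius (Lx_ n) (hA_ n)) (dendroid_arc_radius Lx hA).
  split => //.
    by move=> _ [l l01 <-]; exists (G (shrink l (F x))); [exists l|exact: close].
  move=> _ [l l01 <-]; exists (G (shrink l (F (x_ n)))); first by exists l.
  by rewrite metric_sym; exact: close.
rewrite distrC subr0 ger0_norm; last first.
  by apply: lb_le_inf; [exists (e / 2)|move=> ? [/ltW]].
apply: (@le_lt_trans _ _ (e / 2)); last by lra.
by apply: ge_inf => //; exists 0 => ? [/ltW].
Qed.

(* Every nondegenerate continuum through a point q other than the top contains
   a piece of the leg of q next to q, above q or below q; of three such continua
   two share a direction. *)
Let leg_piece (up : bool) (K : set T) s c :=
  exists2 e, 0 < e & forall s', 0 < s' ->
    (if up then s < s' < s + e else s - e < s' < s) -> (F @` K) (leg_point s' c).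

Let continuum_leg_piece K q x s c : subcontinuum K L -> K q -> K x -> x <> q ->
  F q = leg_point s c -> 0 < s -> exists up, leg_piece up K s c.
Proof.
move=> KL Kq Kx xq Fq s0; have [clK cK KC] := planar_image KL.
have SK z : K z -> (F @` K) (F z) by move=> Kz; exact: imageP.
have Lx := proj1 KL _ Kx; have Lq := proj1 KL _ Kq.
have [[s2 [Fx ss2]]|nup] := pselect (exists s2, F x = leg_point s2 c /\ s < s2).
  exists true, (s2 - s); first by rewrite subr_gt0.
  move=> s' s'0; rewrite addrC subrK => /andP[ss' s's2].
  have [|||//|[s3 + s's3]] := @planar_connected_leg _ C codC (F @` K) s2 c (F q) s' clK cK KC.
  - by rewrite -Fx; exact: SK.
  - exact: SK.
  - by rewrite s'0.
  - rewrite Fq => /leg_point_inj[ss3 _]; rewrite -ss3 in s's3.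
    by have := lt_trans ss' s's3; rewrite ltxx.
(* With [x] not above [q] on its leg, [e] is small enough that [x] is not above any height between
   [s - e] and [s] either; [planar_connected_leg] then forces the piece below [q]. *)
have [e [e0 eP]] : exists e, 0 < e /\
    forall s', s - e < s' < s -> ~ exists2 s3, F x = leg_point s3 c & s' < s3.
  have [[s2 Fx]|nx] := pselect (exists s2, F x = leg_point s2 c); last first.
    by exists 1; split => // s' _ [s3 Fx _]; apply: nx; exists s3.
  have s2s : s2 < s.
    rewrite ltNge le_eqVlt; apply/negP => /orP[/eqP ss2|ss2].
      by apply: xq; apply: F_inj => //; rewrite Fx Fq ss2.
    by apply: nup; exists s2.
  exists (s - s2); split; first by rewrite subr_gt0.
  move=> s'; rewrite subKr => /andP[s2s' _] [s3]; rewrite Fx => /leg_point_inj[<- _].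
  by move=> /(lt_trans s2s'); rewrite ltxx.
exists false, e => // s' s'0 ss'.
have [|||//|] := @planar_connected_leg _ C codC (F @` K) s c (F x) s' clK cK KC.
- by rewrite -Fq; exact: SK.
- exact: SK.
- by rewrite s'0; case/andP: ss'.
- by move=> /eP; case.
Qed.

Let leg_piece_meet up A B q s c : A `<=` L -> B `<=` L -> A `&` B = [set q] ->
  F q = leg_point s c -> 0 < s ->
  leg_piece up A s c -> leg_piece up B s c -> False.
Proof.
move=> AL BL AB Fq s0 [e1 e10 h1] [e2 e20 h2].
have [s' [s'0 ss' s1 s2]] : exists s', [/\ 0 < s', s' <> s,
    (if up then s < s' < s + e1 else s - e1 < s' < s) &
    (if up then s < s' < s + e2 else s - e2 < s' < s)].
  (* Moving from [s] by half of [m] stays inside both pieces and keeps the height positive. *)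
  pose m := Num.min s (Num.min e1 e2).
  have [ms m1 m2] : [/\ m <= s, m <= e1 & m <= e2].
    by split; rewrite /m !ge_min lexx ?orbT.
  have m0 : 0 < m by rewrite /m !lt_min s0 e10.
  move: m ms m1 m2 m0 => m ms m1 m2 m0.
  case: up {h1 h2}; [exists (s + m / 2)|exists (s - m / 2)]; split;
    try (apply/andP; split); lra.
have [a Aa Fa] := h1 _ s'0 s1; have [b Bb Fb] := h2 _ s'0 s2.
have ab : a = b by apply: F_inj; [exact: AL|exact: BL|rewrite Fa Fb].
have : (A `&` B) a by split => //; rewrite ab.
rewrite AB => /= aq; apply: ss'.
by move: Fa; rewrite aq Fq => /leg_point_inj[].
Qed.

Lemma planar_model_ramification s1 c1 s2 c2 s3 c3 :
  (F @` L) (leg_point s1 c1) -> (F @` L) (leg_point s2 c2) ->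
  (F @` L) (leg_point s3 c3) -> 0 < s1 -> 0 < s2 -> 0 < s3 ->
  c1 <> c2 -> c1 <> c3 -> c2 <> c3 ->
  ramification_points L = [set t].
Proof.
move=> P1 P2 P3 s10 s20 s30 c12 c13 c23; apply/seteqP; split.
  move=> q [A [B [D [[AL BL DL] [Aq Bq Dq] [AB AD BD]]]]].
  apply: contrapT => /= qt.
  have Lq : L q by apply: AL; have : (A `&` B) q by [rewrite AB]; case.
  have [c [s [Cc /andP[s0 s1'] Fq]]] := FC (imageP F Lq).
  have {}s0 : 0 < s.
    rewrite lt_neqAle s0 andbT eq_sym; apply/eqP => sz; apply: qt.
    by apply: F_inj => //; rewrite Fq sz leg_point0.
  have piece K : K `<=` L -> arc_endpoint K q -> exists up, leg_piece up K s c.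
    move=> KL /arc_endpointP[x /arc_betweenP[cK Kq Kx qx] _].
    by apply: (@continuum_leg_piece K q x) => //; exact: nesym.
  have [u1 p1] := piece A AL Aq; have [u2 p2] := piece B BL Bq.
  have [u3 p3] := piece D DL Dq.
  have m12 : u1 <> u2.
    by move=> u; rewrite u in p1; exact: leg_piece_meet AL BL AB Fq s0 p1 p2.
  have m13 : u1 <> u3.
    by move=> u; rewrite u in p1; exact: leg_piece_meet AL DL AD Fq s0 p1 p3.
  have m23 : u2 <> u3.
    by move=> u; rewrite u in p2; exact: leg_piece_meet BL DL BD Fq s0 p2 p3.
  by case: u1 u2 u3 m12 m13 m23 {p1 p2 p3} => [] [] [].
have GL p : (F @` L) p -> L (G p) by move=> [x Lx <-]; rewrite GF.
have ar s c : (F @` L) (leg_point s c) -> 0 < s ->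
    arc_endpoint (radius (G (leg_point s c))) t.
  move=> P s0; apply: arc_between_endpoint (radius_arc _ _); first exact: GL.
  move=> Gt; have := FG P; rewrite Gt Ft => /(congr1 snd) /= /esym/eqP.
  by rewrite oppr_eq0 => /eqP sz; rewrite sz ltxx in s0.
have meet s c s' c' : (F @` L) (leg_point s c) -> (F @` L) (leg_point s' c') ->
    0 < s -> c <> c' ->
    radius (G (leg_point s c)) `&` radius (G (leg_point s' c')) = [set t].
  move=> P P' s0 cc'; apply/seteqP; split; last first.
    by move=> _ ->; split; apply: radius_top; exact: GL.
  move=> z [[l l01 <-] [l' l'01]].
  move/(homeomorphism_inj hG (planar_model_leg LL Lt (GL _ P') l'01)
    (planar_model_leg LL Lt (GL _ P) l01)).
  rewrite !FG// !shrink_leg => /leg_point_inj[e h].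
  have [ls|/eqP ls] := eqVneq (l' * s') 0; last first.
    by exfalso; apply: cc'; exact/esym/h.
  by rewrite /= -e ls leg_point0 -Ft GF.
move=> _ ->; exists (radius (G (leg_point s1 c1))), (radius (G (leg_point s2 c2))),
  (radius (G (leg_point s3 c3))); split; split.
all: by [apply: radius_L; exact: GL|exact: ar|exact: meet].
Qed.

End PlanarModel.

(** * Long legs of a Lelek fan *)

Section CantorScheme.
Context {R : realType}.
Variable (Q : set R).
Hypothesis Q_perfect : forall c e, Q c -> 0 < e ->
  exists c', [/\ Q c', c' <> c & `|c' - c| < e].

Let other (q r : R) := xget q [set c | [/\ Q c, c <> q & `|c - q| < r / 2]].

Let otherP q r : Q q -> 0 < r ->
  [/\ Q (other q r), other q r <> q & `|other q r - q| < r / 2].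
Proof.
move=> Qq r0; rewrite /other; case: xgetP => // nq; exfalso.
have [|c [Qc cq cr]] := @Q_perfect q (r / 2) Qq; first by rewrite divr_gt0.
by apply: (nq c).
Qed.

(** With centres at distance d, radii d/3 make the two intervals disjoint; as d is below half the
    old radius r, also d + d/3 < r, so both fit inside. *)
Let child (b : bool) (s : R * R) : R * R :=
  (if b then other s.1 s.2 else s.1, `|other s.1 s.2 - s.1| / 3).

(* The nth node of the tree along the branch a: a centre in Q and a radius; the
   two children have disjoint closed intervals inside the interval of the node. *)
Let node q0 (a : nat -> bool) :=
  fix node (n : nat) : R * R := if n is m.+1 then child (a m) (node m) else (q0, 1).

Let child_spec b s : Q s.1 -> 0 < s.2 -> let s' := child b s in
  [/\ Q s'.1, 0 < s'.2, s'.2 <= s.2 / 2 & `|s'.1 - s.1| + s'.2 <= s.2].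
Proof.
move=> Qs s0; have [Qo os od] := otherP Qs s0.
have o0 : 0 < `|other s.1 s.2 - s.1| by rewrite normr_gt0 subr_eq0; exact/eqP.
rewrite /child /=; move: o0 od; set d := `|_| => d0 ds.
split; [by case: b|by rewrite divr_gt0|lra|].
by case: b; rewrite ?subrr ?normr0 -/d; lra.
Qed.

Let node_spec q0 a n : Q q0 -> let s := node q0 a n in
  [/\ Q s.1, 0 < s.2 & s.2 <= (2 ^+ n)^-1].
Proof.
move=> Qq; elim: n => [|n [Qn n0 n1]] /=; first by rewrite expr0 invr1.
have [? ? h _] := child_spec (a n) Qn n0; split => //.
by apply: le_trans h _; rewrite exprSr invfM ler_pM2r ?invr_gt0.
Qed.

Let node_step q0 a n : Q q0 ->
  `|(node q0 a n.+1).1 - (node q0 a n).1| + (node q0 a n.+1).2 <= (node q0 a n).2.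
Proof. by move=> Qq; have [Qn n0 _] := node_spec a n Qq; have [] := child_spec (a n) Qn n0. Qed.

Let node_nested q0 a m n : Q q0 -> (m <= n)%N ->
  `|(node q0 a n).1 - (node q0 a m).1| + (node q0 a n).2 <= (node q0 a m).2.
Proof.
move=> Qq /subnK <-; elim: (n - m)%N => [|k IH]; first by rewrite subrr normr0 add0r.
rewrite addSn; apply: le_trans IH; have := node_step a (k + m) Qq.
set x := (node q0 a (k + m).+1).1; set y := (node q0 a (k + m)).1.
set z := (node q0 a m).1; have := ler_distD y x z; lra.
Qed.

Let limit q0 a := sup (range (fun n => (node q0 a n).1 - (node q0 a n).2)).

(** By nesting, every left end is at most every right end, so the supremum of the left ends lies in
    all the intervals. *)
Let limitP q0 a n : Q q0 -> `|limit q0 a - (node q0 a n).1| <= (node q0 a n).2.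
Proof.
move=> Qq.
have ub m k : (node q0 a m).1 - (node q0 a m).2 <= (node q0 a k).1 + (node q0 a k).2.
  have [_ m0 _] := node_spec a m Qq; have [_ k0 _] := node_spec a k Qq.
  have [mk|/ltnW km] := leqP m k.
    have := node_nested a Qq mk; have := ler_norm (- ((node q0 a k).1 - (node q0 a m).1)).
    by rewrite normrN; lra.
  have := node_nested a Qq km; have := ler_norm ((node q0 a m).1 - (node q0 a k).1).
  by lra.
have lo : (node q0 a n).1 - (node q0 a n).2 <= limit q0 a.
  apply: ub_le_sup; last by exists n.
  by exists ((node q0 a n).1 + (node q0 a n).2) => _ [m _ <-]; exact: ub.
have hi : limit q0 a <= (node q0 a n).1 + (node q0 a n).2.
  apply: ge_sup; first by exists ((node q0 a n).1 - (node q0 a n).2), n.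
  by move=> _ [m _ <-]; exact: ub.
by rewrite ler_norml; apply/andP; split; lra.
Qed.

Let node_eq q0 a b n : (forall i, (i < n)%N -> a i = b i) -> node q0 a n = node q0 b n.
Proof.
elim: n => // n IH h /=; rewrite IH ?h// => i ni; apply: h; exact: ltnW.
Qed.

Lemma cantor_scheme : Q !=set0 -> exists j : (nat -> bool) -> R,
  [/\ forall a, closure Q (j a),
      forall a b, j a = j b -> a = b
    & forall e, 0 < e -> exists n, forall a b, (forall i, (i < n)%N -> a i = b i) ->
        `|j a - j b| < e].
Proof.
move=> [q0 Qq]; exists (limit q0).
have small e : 0 < e -> exists n, forall a, (node q0 a n).2 < e.
  move=> e0; have [n _ /(_ n (leqnn n)) /= ne] := near_infty_natSinv_expn_lt (PosNum e0).
  exists n => a; have [_ _ h] := node_spec a n Qq.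
  by apply: le_lt_trans h _; rewrite -div1r.
split.
- move=> a B /nbhs_ballP[e e0 eB]; have [n ne] := small e e0.
  have [Qn _ _] := node_spec a n Qq; exists (node q0 a n).1; split => //.
  by apply: eB; rewrite -ball_normE /ball_ /=; exact: le_lt_trans (limitP a n Qq) (ne a).
(* If the sequences first differ at [n], the common limit is within a third of the distance of the
   two child centres from each of them, which is impossible. *)
- move=> a b jab; apply/funext => n; elim/ltn_ind: n => n IH.
  have := limitP a n.+1 Qq; have := limitP b n.+1 Qq; rewrite -jab /=.
  rewrite (node_eq q0 IH); have [Qn n0 _] := node_spec b n Qq.
  have [_ on _] := otherP Qn n0; rewrite /child /=.
  have o0 : 0 < `|other (node q0 b n).1 (node q0 b n).2 - (node q0 b n).1|.
    by rewrite normr_gt0 subr_eq0; exact/eqP.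
  move: o0; set o := other _ _; set q := (node q0 b n).1; set l := limit q0 a => o0.
  have h1 := ler_distD l o q; rewrite (distrC o l) in h1.
  by case: (a n) (b n) => [] [] //= h2 h3; exfalso; lra.
- move=> e e0; have [|n ne] := small (e / 2); first by rewrite divr_gt0.
  exists n => a b ab; have := limitP a n Qq; have := limitP b n Qq.
  rewrite (node_eq q0 ab); have := ne b; have := ler_distD (node q0 b n).1 (limit q0 a) (limit q0 b).
  by rewrite (distrC (node q0 b n).1); lra.
Qed.

End CantorScheme.

(** * Consequences of dense end-points for the legs *)

Section LelekDensity.
Context {R : realType} {U : metricType R} {C : set R}.
Variables (Y : set U) (F : U -> R * R).
Hypotheses (C01 : C `<=` `[0, 1]) (codC : codense C).
Hypotheses (cY : continuum Y) (hF : homeomorphism Y (F @` Y) F)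
  (FC : F @` Y `<=` planar_fan C).
Hypotheses (ndY : Defs.nondegenerate Y) (dY : closure (endpoints Y) `&` Y = Y).
Local Notation I01 := (`[0, 1]%classic : set R).

Let F_inj x y : Y x -> Y y -> F x = F y -> x = y.
Proof. exact: (homeomorphism_inj hF). Qed.

Let YY : subcontinuum Y Y. Proof. by split. Qed.

Let clP : closed (F @` Y). Proof. by have [] := planar_image hF FC YY. Qed.
Let cP : connected (F @` Y). Proof. by have [] := planar_image hF FC YY. Qed.

Let between K x1 x2 e c s1 s s2 : subcontinuum K Y -> K x1 -> K x2 -> Y e ->
  F x1 = leg_point s1 c -> F x2 = leg_point s2 c -> F e = leg_point s c ->
  s1 < s < s2 -> K e.
Proof.
move=> KY K1 K2 Ye F1 F2 Fe /andP[s1s ss2].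
have [clK cK KC] := planar_image hF FC KY.
have [c1 [r [_ /andP[r0 _] F1']]] := KC _ (imageP F K1).
have s0 : 0 < s.
  by apply: le_lt_trans s1s; move: F1'; rewrite F1 => /leg_point_inj[->].
have [|||[z Kz Fz]|[s3]] := @planar_connected_leg _ C codC (F @` K) s2 c (F x1) s clK cK KC.
- by rewrite -F2; exact: imageP.
- exact: imageP.
- by rewrite s0.
- by rewrite -(F_inj (proj1 KY _ Kz) Ye)// Fz Fe.
- by rewrite F1 => /leg_point_inj[<- _] /(lt_trans s1s); rewrite ltxx.
Qed.

(* Otherwise take the arc from x1 to x2 with e as an endpoint: the subarc between
   x1 and x2 misses e, but every subcontinuum containing x1 and x2 contains e. *)
Lemma endpoint_not_between e x1 x2 c s1 s s2 : endpoints Y e -> Y x1 -> Y x2 ->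
  F x1 = leg_point s1 c -> F x2 = leg_point s2 c -> F e = leg_point s c ->
  s1 < s < s2 -> False.
Proof.
move=> [Ye eY] Y1 Y2 F1 F2 Fe ss; have /andP[s1s ss2] := ss.
have x12 : x1 <> x2.
  move=> x12; move: F1; rewrite x12 F2 => /leg_point_inj[e21 _].
  by have := lt_trans s1s ss2; rewrite e21 ltxx.
have e1 : x1 <> e.
  by move=> h; move: F1; rewrite h Fe => /leg_point_inj[e' _]; rewrite e' ltxx in s1s.
have e2 : x2 <> e.
  by move=> h; move: F2; rewrite h Fe => /leg_point_inj[e' _]; rewrite e' ltxx in ss2.
have [A [AY A12 _]] := planar_model_arc C01 codC cY hF FC Y1 Y2 x12.
have [cA A1 A2 _] := arc_betweenP A12.
have Ae : A e by apply: between A1 A2 Ye F1 F2 Fe ss.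
have [x [k [hk k0 _]] _] := arc_endpointP (eY A AY (arc_between_arc A12) Ae).
have [a a01 ka] : exists2 a, I01 a & k a = x1.
  by move: A1; rewrite -(homeomorphism_image hk) => -[a a01 <-]; exists a.
have [b b01 kb] : exists2 b, I01 b & k b = x2.
  by move: A2; rewrite -(homeomorphism_image hk) => -[b b01 <-]; exists b.
have kE l : I01 l -> k l = e -> l = 0.
  by move=> l01; rewrite -k0 => /(homeomorphism_inj hk l01); apply; exact: zero_I01.
have sub l r : I01 l -> I01 r -> 0 < l -> l < r -> subcontinuum (k @` `[l, r]) Y /\
    ~ (k @` `[l, r]) e.
  rewrite /= !in_itv /= => /andP[l0' l1] /andP[r0 r1] l0 lr; split.
    split; last by have [] := arc_betweenP (subarc hk l0' lr r1).
    move=> _ [z zlr <-]; apply: AY; rewrite -(homeomorphism_image hk); apply: imageP.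
    by move: zlr; rewrite /= !in_itv /= => /andP[/(le_trans l0') -> /le_trans ->].
  move=> [z]; rewrite /= in_itv /= => /andP[lz zr] /kE z0.
  have zz : z = 0 by apply: z0; rewrite /= in_itv /= (le_trans l0' lz) (le_trans zr).
  by move: lz; rewrite zz leNgt l0.
have pos l : I01 l -> k l <> e -> 0 < l.
  rewrite /= in_itv /= => /andP[l0 _] kl; rewrite lt_neqAle l0 andbT eq_sym.
  by apply/eqP => lz; apply: kl; rewrite lz.
have a0 : 0 < a by apply: pos => //; rewrite ka.
have b0 : 0 < b by apply: pos => //; rewrite kb.
have [ab|ba|ab] := ltgtP a b.
- have [KY nKe] := sub a b a01 b01 a0 ab; apply: nKe.
  apply: between KY _ _ Ye F1 F2 Fe ss; [exists a|exists b] => //;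
    by rewrite /= in_itv /= lexx ?(ltW ab).
- have [KY nKe] := sub b a b01 a01 b0 ba; apply: nKe.
  apply: between KY _ _ Ye F1 F2 Fe ss; [exists a|exists b] => //;
    by rewrite /= in_itv /= lexx ?(ltW ba).
- by apply: x12; rewrite -ka -kb ab.
Qed.

(** An end-point close to the middle of the segment cannot lie between its ends on the same leg, so
    it lies on another one. *)
Lemma lelek_density s1 s2 c e : (F @` Y) (leg_point s1 c) -> (F @` Y) (leg_point s2 c) ->
  s1 < s2 -> 0 < e -> exists r c',
  [/\ (F @` Y) (leg_point r c'), s1 < r < s2, c' <> c & `|c' - c| < e].
Proof.
move=> P1 P2 s12 e0.
have [c1 [r1 [Cc1 /andP[r10 _] e1]]] := FC P1.
have s10 : 0 <= s1 by move: e1 => /leg_point_inj[->].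
have [c2 [r2 [Cc2 _ e2]]] := FC P2.
have Cc : C c.
  move: e2 => /leg_point_inj[_ ->] //; apply/eqP; rewrite gt_eqF//.
  exact: le_lt_trans s12.
have /andP[c0 c1'] : 0 <= c <= 1 by have := C01 Cc; rewrite /= in_itv.
pose m := (s1 + s2) / 2.
have m0 : 0 < m by rewrite /m; lra.
have [z Yz Fz] : (F @` Y) (leg_point m c).
  have [|//|[s3]] := @planar_connected_leg _ C codC (F @` Y) s2 c (leg_point s1 c) m clP cP FC P2 P1.
    by rewrite m0 /m; lra.
  by move=> /leg_point_inj[<- _]; rewrite /m; lra.
(* The three bounds keep the height [r] between [s1] and [s2], keep it at least m/2, and make the
   slopes differ by less than 2d / (m/2) <= e. *)
pose d := Num.min ((s2 - s1) / 2) (Num.min (m / 2) (e * m / 4)).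
have [d1 d2 d3] : [/\ d <= (s2 - s1) / 2, d <= m / 2 & d <= e * m / 4].
  by split; rewrite /d !ge_min lexx ?orbT.
have d0 : 0 < d.
  have em : 0 < e * m by rewrite mulr_gt0.
  by rewrite /d !lt_min; apply/and3P; split; lra.
move: d d0 d1 d2 d3 => d d0 d1 d2 d3.
have [b b0 bP] := (within_ballP _ _).1 (homeomorphism_continuous hF) z Yz d d0.
have [clz _] : (closure (endpoints Y) `&` Y) z by rewrite dY.
have [w [[Yw eYw] zw]] := clz _ (nbhsx_ballx z b b0).
have [c' [r [Cc' _ Fw]]] := FC (imageP F Yw).
have := bP w Yw zw; rewrite Fz Fw => -[].
rewrite -!ball_normE /ball_ /= !ltr_norml => /andP[h1 h2] /andP[h3 h4].
have mr : s1 < r < s2 by move: h3 h4 d1; rewrite /m => *; apply/andP; split; lra.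
exists r, c'; split => //; first by rewrite -Fw; exact: imageP.
  move=> cc'; case: P1 => x1 Y1 F1; case: P2 => x2 Y2 F2.
  apply: (@endpoint_not_between w x1 x2 c s1 r s2) => //.
  by rewrite Fw cc'.
have rm : m / 2 <= r by lra.
have rd1 : r * (c' - c) < 2 * d by nra.
have rd2 : - (2 * d) < r * (c' - c) by nra.
rewrite ltr_norml; apply/andP; split; rewrite ltNge; apply/negP => h.
  have : r * (c' - c) <= (m / 2) * (- e) by nra.
  by nra.
have : (m / 2) * e <= r * (c' - c) by nra.
by nra.
Qed.

Let different_slopes s c s' c' : (F @` Y) (leg_point s c) -> (F @` Y) (leg_point s' c') ->
  0 < s -> 0 < s' -> c <> c' -> (F @` Y) 0.
Proof.
move=> P P' s0 s'0 cc'.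
have [c1 [r1 [Cc1 _ e1]]] := FC P.
have Cc : C c by move: e1 => /leg_point_inj[_ ->] //; apply/eqP; rewrite gt_eqF.
apply: (planar_connected_origin C01 clP Cc s0) => r rs.
have [|//|[s3 + _]] := @planar_connected_leg _ C codC (F @` Y) s c (leg_point s' c') r clP cP FC P P'.
  exact: rs.
by move=> /leg_point_inj[_ h]; exfalso; apply/cc'/esym/h/eqP; rewrite gt_eqF.
Qed.

(** Points on two different legs force the origin; if the given points share a leg, [lelek_density]
    supplies another one. *)
Lemma lelek_top : (F @` Y) 0.
Proof.
have [x [y [Yx Yy xy]]] := ndY.
have [c [s [Cc /andP[s0 _] Fx]]] := FC (imageP F Yx).
have [c' [s' [Cc' /andP[s'0 _] Fy]]] := FC (imageP F Yy).
have Px : (F @` Y) (leg_point s c) by rewrite -Fx; exact: imageP.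
have Py : (F @` Y) (leg_point s' c') by rewrite -Fy; exact: imageP.
have [sz|sn0] := eqVneq s 0; first by rewrite -(leg_point0 c) -sz.
have [s'z|s'n0] := eqVneq s' 0; first by rewrite -(leg_point0 c') -s'z.
have sp : 0 < s by rewrite lt_neqAle eq_sym sn0.
have sp' : 0 < s' by rewrite lt_neqAle eq_sym s'n0.
have [cc'|/eqP cc'] := eqVneq c c'; last exact: different_slopes Px Py sp sp' cc'.
have same a b g : (F @` Y) (leg_point a g) -> (F @` Y) (leg_point b g) -> 0 < a -> a < b ->
    (F @` Y) 0.
  move=> Pa Pb a0 ab; have [r [g' [Pr /andP[ar rb] gg' _]]] := lelek_density Pa Pb ab ltr01.
  by apply: (different_slopes Pr Pb) => //; [exact: lt_trans ar|exact: lt_trans ab].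
rewrite -cc' in Py Fy; have [ss|ss|ss] := ltgtP s s'.
- exact: same Px Py sp ss.
- exact: same Py Px sp' ss.
- by exfalso; apply/xy/F_inj => //; rewrite Fx Fy ss.
Qed.

Lemma lelek_leg s s' c : (F @` Y) (leg_point s c) -> 0 <= s' <= s ->
  (F @` Y) (leg_point s' c).
Proof.
move=> P /andP[s'0 s's].
have [sz|sn0] := eqVneq s' 0; first by rewrite sz leg_point0; exact: lelek_top.
have [->//|ss] := eqVneq s' s.
have sp : 0 < s' by rewrite lt_neqAle eq_sym sn0.
have [|//|[s3]] := @planar_connected_leg _ C codC (F @` Y) s c 0 s' clP cP FC P lelek_top.
  by rewrite sp lt_neqAle ss.
move=> /(congr1 snd) /= /esym/eqP; rewrite oppr_eq0 => /eqP ->.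
by move=> /(lt_trans sp); rewrite ltxx.
Qed.

Lemma lelek_long_legs : exists2 h, 0 < h & exists Q : set R,
  [/\ Q !=set0,
      forall c e, Q c -> 0 < e -> exists c', [/\ Q c', c' <> c & `|c' - c| < e]
    & forall c, closure Q c -> (F @` Y) (leg_point h c)].
Proof.
have [c [s [Ps s0]]] : exists c s, (F @` Y) (leg_point s c) /\ 0 < s.
  have [x [y [Yx Yy xy]]] := ndY.
  have [c [s [Cc /andP[s0 _] Fx]]] := FC (imageP F Yx).
  have [c' [s' [Cc' /andP[s'0 _] Fy]]] := FC (imageP F Yy).
  have [sz|sn0] := eqVneq s 0; last first.
    by exists c, s; rewrite lt_neqAle eq_sym sn0 -Fx; split => //; exact: imageP.
  have [s'z|s'n0] := eqVneq s' 0; last first.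
    by exists c', s'; rewrite lt_neqAle eq_sym s'n0 -Fy; split => //; exact: imageP.
  by exfalso; apply/xy/F_inj => //; rewrite Fx Fy sz s'z !leg_point0.
have h0 : 0 < s / 2 by rewrite divr_gt0.
exists (s / 2) => //.
(* Strict inequality leaves a segment between the heights s/2 and r, where [lelek_density] finds new
   slopes, again of legs longer than s/2. *)
exists [set g | exists2 r, s / 2 < r & (F @` Y) (leg_point r g)]; split.
- by exists c, s => //; lra.
- move=> g e [r hr Pr] e0.
  have Ph : (F @` Y) (leg_point (s / 2) g).
    by apply: lelek_leg Pr _; rewrite !ltW.
  have [r' [g' [Pr' /andP[hr' _] gg' ge]]] := lelek_density Ph Pr hr e0.
  by exists g'; split => //; exists r'.
- move=> g clg; apply: contrapT => nP.
  have [e e0 eP] := (closed_ballP _).1 clP _ nP.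
  have e1 : 0 < e / (s / 2) by rewrite divr_gt0.
  have [g' [[r hr Pr] gg']] := clg _ (nbhsx_ballx g _ e1).
  apply: (eP (leg_point (s / 2) g')); last by apply: lelek_leg Pr _; rewrite !ltW.
  split; rewrite -ball_normE /ball_ /= ?subrr ?normr0//.
  move: gg'; rewrite -ball_normE /ball_ /= -mulrBr normrM (gtr0_norm h0).
  by rewrite ltr_pdivlMr// mulrC.
Qed.

End LelekDensity.

(** * Embedding into a cone over a Cantor set of slopes *)

Section SmoothFanEmbedding.
Context {R : realType} {T : metricType R}.
Variables (Z : set T) (t : T) (f : T -> R) (k : T -> nat -> bool).
Variables (j : (nat -> bool) -> R) (h : R).
Hypotheses (Zt : Z t) (cf : {within Z, continuous f}) (ft : f t = 0).
Hypotheses (f_gt0 : forall x, Z x -> x <> t -> 0 < f x).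
Hypotheses (k_loc : forall n x, Z x -> x <> t -> exists2 e : R, 0 < e &
  forall y, Z y -> ball x e y -> k y n = k x n).
Hypotheses (fk_inj : forall x y, Z x -> Z y -> x <> t -> y <> t ->
  f x = f y -> k x = k y -> x = y).
Hypotheses (j01 : forall a, 0 <= j a <= 1) (j_inj : forall a b, j a = j b -> a = b).
Hypothesis j_cont : forall e, 0 < e -> exists n, forall a b,
  (forall i, (i < n)%N -> a i = b i) -> `|j a - j b| < e.
Hypothesis (h0 : 0 < h).

Let emb x := leg_point (h * f x) (j (k x)).

Let k_near n x : Z x -> x <> t -> exists2 e : R, 0 < e &
  forall y, Z y -> ball x e y -> forall i, (i < n)%N -> k x i = k y i.
Proof.
move=> Zx xt; elim: n => [|n [e e0 eP]]; first by exists 1.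
have [d d0 dP] := k_loc n Zx xt; exists (Num.min e d); first by rewrite lt_min e0.
move=> y Zy xy i; rewrite ltnS leq_eqVlt => /orP[/eqP ->|ni].
  by apply/esym/dP => //; apply: le_ball xy; rewrite ge_min lexx orbT.
by apply: eP ni => //; apply: le_ball xy; rewrite ge_min lexx.
Qed.

Let f_near x e : Z x -> 0 < e ->
  exists2 d, 0 < d & forall y, Z y -> ball x d y -> `|f x - f y| < e.
Proof.
move=> Zx e0; have [d d0 dP] := (within_ballP _ _).1 cf x Zx e e0.
by exists d => // y Zy xy; have := dP y Zy xy; rewrite -ball_normE.
Qed.

Let jk_near x e : Z x -> x <> t -> 0 < e ->
  exists2 d, 0 < d & forall y, Z y -> ball x d y -> `|j (k x) - j (k y)| < e.
Proof.
move=> Zx xt e0; have [n nP] := j_cont e0; have [d d0 dP] := k_near n Zx xt.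
by exists d => // y Zy xy; apply: nP => i; exact: dP.
Qed.

Lemma leg_embedding_continuous : {within Z, continuous emb}.
Proof.
apply/within_ballP => x Zx e e0.
have e2 : 0 < e / 2 by rewrite divr_gt0.
have [d d0 dP] := f_near Zx (divr_gt0 e2 h0).
have fP y : Z y -> ball x d y -> `|h * f x - h * f y| < e / 2.
  by move=> Zy xy; rewrite -mulrBr normrM (gtr0_norm h0) mulrC -ltr_pdivlMr// dP.
have jP y : `|(h * f x - h * f y) * j (k y)| <= `|h * f x - h * f y|.
  by have /andP[? ?] := j01 (k y); rewrite normrM ler_piMr// ger0_norm.
(* The slope varies continuously away from [t]; at [t] its variation is multiplied by the height
   0. *)
have [c c0 cP] : exists2 c, 0 < c & forall y, Z y -> ball x c y ->
    `|h * f x * (j (k x) - j (k y))| < e / 2.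
  have [xt|/eqP xt] := eqVneq x t.
    by exists 1 => // y _ _; rewrite xt ft mulr0 mul0r normr0.
  have hf : 0 < h * f x by rewrite mulr_gt0// f_gt0.
  have [c c0 cP] := jk_near Zx xt (divr_gt0 e2 hf).
  by exists c => // y Zy xy; rewrite normrM (gtr0_norm hf) mulrC -ltr_pdivlMr// cP.
exists (Num.min d c); first by rewrite lt_min d0.
have [mind minc] : Num.min d c <= d /\ Num.min d c <= c.
  by rewrite !ge_min !lexx orbT.
move=> y Zy xy.
have {}fP := fP y Zy (le_ball mind xy).
have {}cP := cP y Zy (le_ball minc xy).
have {}jP := le_lt_trans (jP y) fP.
split; rewrite -ball_normE /ball_ /=; last first.
  by rewrite -opprD normrN; apply: lt_trans fP _; lra.
rewrite (_ : _ - _ = (h * f x - h * f y) * j (k y) + h * f x * (j (k x) - j (k y))); last by ring.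
by apply: le_lt_trans (ler_normD _ _) _; lra.
Qed.

Lemma leg_embedding_inj x y : Z x -> Z y -> emb x = emb y -> x = y.
Proof.
move=> Zx Zy /leg_point_inj[/(mulfI _) fxy jxy].
have {}fxy : f x = f y by apply: fxy; rewrite gt_eqF.
have [xt|/eqP xt] := eqVneq x t; have [yt|/eqP yt] := eqVneq y t.
- by rewrite xt yt.
- by have := f_gt0 Zy yt; rewrite -fxy xt ft ltxx.
- by have := f_gt0 Zx xt; rewrite fxy yt ft ltxx.
- apply: fk_inj => //; apply: j_inj; apply: jxy; apply/eqP.
  by rewrite mulf_neq0// gt_eqF// f_gt0.
Qed.

End SmoothFanEmbedding.

Theorem mainTheorem2 (R : realType) (T : metricType R) (L : set T) :
  lelek_fan L -> universal_continuum (@smooth_fan R) L.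
Proof.
move=> [cL [U [X [Y [[cX [C [C01 /cantor_set_codense codC [phi hphi]]]] [YX cY] ndY dY]]]]].
move=> [psi hpsi]; rewrite planar_fanE in hphi.
have hY := homeomorphism_sub hphi YX.
have YC : phi @` Y `<=` planar_fan C.
  by rewrite -(homeomorphism_image hphi); exact: image_subset.
have hL := homeomorphism_comp hpsi hY.
set F := phi \o psi in hL; have FL := homeomorphism_image hL.
rewrite -FL in hL; have LC : F @` L `<=` planar_fan C by rewrite FL.
have [t Lt Ft] : (F @` L) 0.
  by rewrite FL; exact: lelek_top C01 codC cY hY YC ndY dY.
have [h h0 [Q [Q0 Qperf Qleg]]] := lelek_long_legs C01 codC cY hY YC ndY dY.
have leg s s' c : (F @` L) (leg_point s c) -> 0 <= s' <= s -> (F @` L) (leg_point s' c).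
  by rewrite FL; exact: (lelek_leg C01 codC cY hY YC ndY dY).
rewrite -FL in Qleg; split.
  exists t; split; last first.
    move=> x_ x A_ A; exact: (planar_model_smooth codC cL hL LC Lt Ft).
  split; first exact: (planar_model_dendroid C01 codC cL hL LC).
  (* Three long legs for the ramification at the top: [c3] is taken nearer to [c1] than [c2] is,
     hence is different from [c2]. *)
  have [c1 Q1] := Q0; have [c2 [Q2 /nesym c12 _]] := Qperf c1 1 Q1 ltr01.
  have c0 : 0 < `|c2 - c1| by rewrite normr_gt0 subr_eq0 eq_sym; exact/eqP.
  have [c3 [Q3 /nesym c13 c31]] := Qperf c1 _ Q1 c0.
  have c23 : c2 <> c3 by move=> c23; rewrite -c23 ltxx in c31.
  by apply: (planar_model_ramification C01 codC cL hL LC Lt Ft _ _ _ h0 h0 h0 c12 c13 c23);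
    apply: Qleg; exact: subset_closure.
move=> V Z [z [fanZ smoothZ]].
have [f [cf fz f01 f_mono]] := smooth_fan_height fanZ smoothZ.
have [k [k_loc fk_inj]] := smooth_fan_itinerary fanZ cf fz f_mono.
have [j [jQ j_inj j_cont]] := cantor_scheme Qperf Q0.
(* The leg of slope [j a] reaches height h > 0 inside the planar fan, so its slope belongs to
   [C]. *)
have j01 a : 0 <= j a <= 1.
  have [c [s [Cc _]]] := LC _ (Qleg _ (jQ a)) => /leg_point_inj[_ ->].
    by have := C01 _ Cc; rewrite /= in_itv.
  by apply/eqP; rewrite gt_eqF.
have dZ : dendroid Z by case: fanZ.
have kZ : compact Z by case: dZ => -[].
have Zz : Z z.
  case: fanZ => _ rZ; have : ramification_points Z z by rewrite rZ.
  move=> [A [B [D [[AZ _ _] _ [AB _ _]]]]]; apply: AZ.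
  suff [] : (A `&` B) z by [].
  by rewrite AB.
have f_gt0 x : Z x -> x <> z -> 0 < f x.
  move=> Zx xz; rewrite -fz; apply: f_mono => //; last exact/nesym.
  exact: (branch_top_mem dZ Zz Zx).
have [G [hG GF FG]] := homeomorphism_inv hL.
pose E x := leg_point (h * f x) (j (k x)).
have EL x : Z x -> (F @` L) (E x).
  (* As [f] is at most 1, scaling by [h] keeps the heights within the guaranteed length of the
     legs. *)
  move=> Zx; apply: leg (Qleg _ (jQ _)) _; have /andP[fx0 fx1] := f01 _ Zx.
  by rewrite mulr_ge0 ?(ltW h0)//= ler_piMr// ltW.
exists (G \o E); split; first by move=> _ [x /EL [y Ly Fy] <-] /=; rewrite -Fy GF.
apply: compact_injective_homeomorphism => //.
- exact: metric_hausdorff.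
- by exists z.
- apply: (within_comp _ EL (homeomorphism_continuous hG)).
  exact: (leg_embedding_continuous cf fz f_gt0 k_loc j01 j_cont h0).
- move=> x y Zx Zy /(homeomorphism_inj hG (EL _ Zx) (EL _ Zy)).
  exact: (leg_embedding_inj fz f_gt0 fk_inj j_inj h0).
Qed.
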